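(* Assume that the quadrature assumption (Q), the finite element assumption (F) and the mixed-regularity assumption (M) stated in the context hold. Further, assume that $U_{\mathrm{ad}}=U$. Set $\alpha:=\min(\alpha_W,\alpha_Z)$ and $\beta:=\min(\alpha,\widetilde\alpha)$. Then the multilevel approximation $u^{\mathrm{MQ}(L)}$ satisfies the error bound $$\mathbb{E}\left[\|u^\star-u^{\mathrm{MQ}(L)}\|_U^2\right]\le 2C_1^2h_L^{2\alpha}+C_3^2\,L\sum_{\ell=0}^L h_\ell^{2\beta}\gamma_{L-\ell}^2,$$ for two positive constants $C_1$ and $C_3$.
   Context: Setting. $\mathcal D\subset\mathbb R^d$ is a bounded Lipschitz domain, $V$ a Sobolev space on $\mathcal D$ (e.g. $H^1(\mathcal D)$ with suitable boundary conditions), $(\Omega,\mathcal F,\mathbb P)$ a complete probability space. For $\mathbb P$-a.e. $\omega$, $a_\omega:V\times V\to\mathbb R$ is a continuous coercive bilinear form (constants may depend on $\omega$). $S^\omega,S^{\omega,\star}:V'\to V$ are defined by $a_\omega(S^\omega g,v)=\langle g,v\rangle_{V',V}$ and $a_\omega(v,S^{\omega,\star}g)=\langle g,v\rangle_{V',V}$ for all $v\in V$. The continuity constant $C_S(\omega)$ of $S^\omega$ lies in $L^q(\Omega;\mathbb R)$ for any $q\in[1,\infty)$. $U,H$ are Hilbert spaces with Riesz isomorphisms $\Lambda_U:U\to U'$, $\Lambda_H:H\to H'$; $Z,W$ are Hilbert spaces with $V\subsetneq Z$, $V\subsetneq W$; the control operator $\mathcal B:U\to Z'$ and the observation operator $\mathcal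 C:W\to H$ are linear and continuous (so $\mathcal C^\star:H'\to W'$); $y_d\in H$, $\nu>0$; $U_{\mathrm{ad}}\subset U$ is the closed convex set of admissible controls. Spatial discretization. $\{V_\ell\}_{\ell\ge0}$ are finite-dimensional subspaces of $V$ associated with regular triangulations of $\mathcal D$ of mesh sizes $h_\ell$, with $\tau:=\sup_{\ell\ge1}h_{\ell-1}/h_\ell<\infty$. $S^\omega_\ell,S^{\omega,\star}_\ell:V'\to V_\ell$ are the Galerkin versions: $a_\omega(S^\omega_\ell g,v)=\langle g,v\rangle_{V',V}$, $a_\omega(v,S^{\omega,\star}_\ell g)=\langle g,v\rangle_{V',V}$ for all $v\in V_\ell$. Adjoint variables. $p^\omega(u):=S^{\omega,\star}\mathcal C^\star\Lambda_H(y_d-\mathcal C S^\omega\mathcal Bu)$ and $p^\omega_\ell(u):=S^{\omega,\star}_\ell\mathcal C^\star\Lambda_H(y_d-\mathcal C S^\omega_\ell\mathcal Bu)$. Quadrature. $\mathcal Q^k[X]=\sum_{j=1}^{N_k}\zeta^k_jX(\xi^k_j)$, $k\ge0$, with nodes $\xi_j^k$ and positive weights $\zeta_j^k$. Optimal controls. $u^\star$ is the unique minimizer over $U_{\mathrm{ad}}$ of $J(u)=\frac12\mathbb E[\|\mathcal C S^\omega\mathcal Bu-y_d\|_H^2]+\frac\nu2\|u\|_U^2$. $u^\star_{\ell,\infty}$ is the minimizer when $S^\omega$ is replaced by $S^\omega_\ell$; $u^\star_{\ell,k}$ (random through the nodes of $\mathcal Q^k$) is the minimizer of $J_{\ell,k}(u)=\frac12\mathcal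 Q^k[\|\mathcal C S^\omega_\ell\mathcal Bu-y_d\|_H^2]+\frac\nu2\|u\|_U^2$. Multilevel approximation. Let $L$ be an integer (the level). With $\mathcal P_{U_{\mathrm{ad}}}$ the projection onto $U_{\mathrm{ad}}$ (the identity if $U_{\mathrm{ad}}=U$) and the convention that terms with spatial index $-1$ vanish, $$u^{\mathrm{MQ}(L)}:=\mathcal P_{U_{\mathrm{ad}}}\Big(\tfrac1\nu\Lambda_U^{-1}\mathcal B^\star\sum_{\ell=0}^L\mathcal Q^{L-\ell}\big[p_\ell(u^\star_{\ell,L-\ell})-p_{\ell-1}(u^\star_{\ell-1,L-\ell})\big]\Big),$$ where on each level the same quadrature formula $\mathcal Q^{L-\ell}$ defines both the controls and the outer average. The expectation in the claim is over the randomness of the quadrature formulae. (Q) The formulae $\{\mathcal Q^k\}_{k\ge0}$ are random, unbiased and statistically independent. Further, for any $q\in[2,\infty)$ there are a normed vector space of functions $H_q(\Omega;Z)$ and a constant $\widetilde C_{\mathcal Q,q}>0$ such that for every $f\in H_q(\Omega;Z)$ and $k\ge0$: $\mathbb E\big[\|\mathbb E[f]-\mathcal Q^k[f]\|_Z^q\big]^{1/q}\le\widetilde C_{\mathcal Q,q}\,\gamma_k\,\|f\|_{H_q(\Omega;Z)}$ (outer expectation over the quadrature randomness, inner one with respect to $\mathbb P$), where $\{\gamma_k\}_{k\ge0}$ is a decreasing null sequence. (F) There are subspaces $K,\widetilde K$ of $V$ with $\mathrm{Im}(S^\omega\mathcal B)\subset K$, $\mathrm{Im}(S^{\omega,\star}\mathcal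 C^\star\Lambda_H)\subset\widetilde K$, these operators being continuous from $U$ to $K$ and from $H$ to $\widetilde K$, respectively; and for $\mathbb P$-a.e. $\omega$, $\|(S^\omega-S^\omega_\ell)\mathcal Bu\|_W\le C_a(\omega)h_\ell^{\alpha_W}\|u\|_U$ for all $u\in U$, and $\|(S^{\omega,\star}-S^{\omega,\star}_\ell)\mathcal C^\star\Lambda_Hh\|_Z\le C_a^\star(\omega)h_\ell^{\alpha_Z}\|h\|_H$ for all $h\in H$, for given $\alpha_W,\alpha_Z>0$ and positive $C_a(\omega),C_a^\star(\omega)$ with $C_a,C_a^\star\in L^q(\Omega;\mathbb R)$ for any $q\in[1,\infty)$. (M) There is $\overline q\in(2,\infty)$ such that for every $u\in U$ and $q\in[2,\overline q]$, $p(u)$ and $p_\ell(u)$ belong to $H_q(\Omega;Z)$. Further, there are a rate $\widetilde\alpha>0$ and a constant $C_{H,q}>0$ such that $\|p(u^\star)-p_\ell(u^\star_{\ell,\infty})\|_{H_q(\Omega;Z)}\le C_{H,q}h_\ell^{\widetilde\alpha}(\|u^\star\|_U+\|y_d\|_H)$. *)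

(* Defs.v *)
From HB Require Import structures.
From mathcomp Require Import all_boot all_order all_algebra.
From mathcomp Require Import all_classical all_reals all_analysis.
From mathcomp Require Import ring.
Set Implicit Arguments.
Unset Strict Implicit.
Unset Printing Implicit Defensive.
Import Order.TTheory GRing.Theory Num.Theory.
Import numFieldNormedType.Exports.
Local Open Scope classical_set_scope.
Local Open Scope ring_scope.

(* Continuous linear maps V -> W, a normed space under the operator norm. *)
Section contlin.
Context (R : realType) (V W : normedModType R).

Definition contlin_pred : {pred V -> W} :=
  mem [set f : V -> W | linear f /\ continuous f].

Record contlin := ContLin { contlin_fun :> V -> W ;
  contlin_subproof : contlin_fun \in contlin_pred }.

HB.instance Definition _ := [isSub for contlin_fun].
HB.instance Definition _ := [Choice of contlin by <:].

Lemma contlinP (f : contlin) : linear f /\ continuous f.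
Proof. by have := contlin_subproof f; rewrite inE. Qed.

Fact contlin_submod : submod_closed contlin_pred.
Proof.
split.
  rewrite inE; split; last exact: cst_continuous.
  by move=> a x y /=; rewrite scaler0 addr0.
move=> a f g; rewrite !inE => -[lf cf] [lg cg]; split.
  move=> b x y.
  change (a *: f (b *: x + y) + g (b *: x + y) =
          b *: (a *: f x + g x) + (a *: f y + g y)).
  by rewrite lf lg !scalerDr !scalerA (mulrC a b) addrACA.
move=> x; apply: cvgD; last exact: cg.
by apply: cvgZr; exact: cf.
Qed.
HB.instance Definition _ := GRing.isSubmodClosed.Build R (V -> W) contlin_pred contlin_submod.
HB.instance Definition _ := [SubChoice_isSubLmodule of contlin by <:].

HB.instance Definition _ (f : contlin) :=
  GRing.isLinear.Build R V W *:%R f (contlinP f).1.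

Definition opnorm (f : contlin) : R := sup [set `|f v| | v in [set v | `|v| <= 1]].

Fact contlin_bounded (f : contlin) :
  exists2 M : R, 0 <= M & forall v, `|f v| <= M * `|v|.
Proof.
have : bounded_near f (nbhs (0 : V)).
  by apply/linear_bounded_continuous; exact: (contlinP f).2.
move=> /linear_boundedP /pinfty_ex_gt0[M M0 fM].
by exists M => //; exact: ltW.
Qed.

Fact opnorm_has_sup (f : contlin) :
  has_sup [set `|f v| | v in [set v | `|v| <= 1]].
Proof.
split; first by exists `|f 0|; exists 0 => //=; rewrite normr0.
have [M M0 fM] := contlin_bounded f.
exists M => _ [v /= v1 <-]; rewrite (le_trans (fM v))//.
by rewrite -[leRHS]mulr1 ler_wpM2l.
Qed.

Fact le_opnorm (f : contlin) v : `|f v| <= opnorm f * `|v|.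
Proof.
have [->|v0] := eqVneq v 0; first by rewrite linear0 !normr0 mulr0.
have nv : 0 < `|v| by rewrite normr_gt0.
rewrite -ler_pdivrMr//.
have -> : `|f v| / `|v| = `|f (`|v|^-1 *: v)|.
  by rewrite linearZ/= normrZ ger0_norm ?invr_ge0// mulrC.
apply: ub_le_sup; first exact: (opnorm_has_sup f).2.
exists (`|v|^-1 *: v) => //=.
by rewrite normrZ ger0_norm ?invr_ge0// mulVf// gt_eqF.
Qed.

Fact opnorm_ge0 (f : contlin) : 0 <= opnorm f.
Proof.
apply: (le_trans (normr_ge0 (f 0))).
by apply: ub_le_sup; [exact: (opnorm_has_sup f).2|exists 0 => //=; rewrite normr0].
Qed.

Fact opnorm_le (f : contlin) M : (forall v, `|v| <= 1 -> `|f v| <= M) -> opnorm f <= M.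
Proof.
move=> fM; apply: ge_sup; first exact: (opnorm_has_sup f).1.
by move=> _ [v /= v1 <-]; exact: fM.
Qed.

Fact ler_opnormD (f g : contlin) : opnorm (f + g) <= opnorm f + opnorm g.
Proof.
apply: opnorm_le => v v1.
rewrite (le_trans (ler_normD (f v) (g v)))// lerD//.
  by rewrite (le_trans (le_opnorm f v))// -[leRHS]mulr1 ler_wpM2l// opnorm_ge0.
by rewrite (le_trans (le_opnorm g v))// -[leRHS]mulr1 ler_wpM2l// opnorm_ge0.
Qed.

Fact opnormZ_le a (f : contlin) : opnorm (a *: f) <= `|a| * opnorm f.
Proof.
apply: opnorm_le => v v1; rewrite [(a *: f) v]/(a *: f v) normrZ ler_wpM2l//.
by rewrite (le_trans (le_opnorm f v))// -[leRHS]mulr1 ler_wpM2l// opnorm_ge0.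
Qed.

Fact opnormZ a (f : contlin) : opnorm (a *: f) = `|a| * opnorm f.
Proof.
apply/eqP; rewrite eq_le opnormZ_le/=.
have [->|a0] := eqVneq a 0; first by rewrite normr0 mul0r opnorm_ge0.
have na : 0 < `|a| by rewrite normr_gt0.
rewrite -ler_pdivlMl//.
have {1}-> : f = a^-1 *: (a *: f) by rewrite scalerA mulVf// scale1r.
by rewrite -normfV; exact: opnormZ_le.
Qed.

Fact opnorm0_eq0 (f : contlin) : opnorm f = 0 -> f = 0.
Proof.
move=> f0; apply/val_inj/funext => v /=.
by apply/normr0_eq0/eqP; rewrite eq_le normr_ge0 andbT -(mul0r `|v|) -f0 le_opnorm.
Qed.

HB.instance Definition _ := @Lmodule_isNormed.Build R contlin opnorm
  ler_opnormD opnormZ opnorm0_eq0.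

End contlin.

Notation dual V := (contlin V _^o).

Fact comp_contlin_subproof (R : realType) (V W X : normedModType R)
    (g : contlin W X) (f : contlin V W) : g \o f \in @contlin_pred R V X.
Proof.
rewrite inE; split; first by move=> a x y /=; rewrite !linearP.
move=> x; apply: continuous_comp; first exact: (contlinP f).2.
exact: (contlinP g).2.
Qed.

Definition comp_contlin (R : realType) (V W X : normedModType R)
  (g : contlin W X) (f : contlin V W) : contlin V X :=
  ContLin (comp_contlin_subproof g f).

HB.mixin Record CompleteNormedModule_isHilbert (R : realType) (V : Type)
    & CompleteNormedModule R V := {
  inner : V -> V -> R ;
  innerC : forall x y, inner x y = inner y x ;
  inner_scalar : forall x, scalar (inner x) ;
  inner_norm : forall x, inner x x = `|x| ^+ 2 }.

#[short(type="hilbertType")]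
HB.structure Definition Hilbert (R : realType) :=
  {V of CompleteNormedModule R V & CompleteNormedModule_isHilbert R V}.

Section hilbert.
Context (R : realType).

Fact inner_le_norm (X : hilbertType R) (x y : X) :
  `|inner x y| <= `|x| * `|y|.
Proof.
have innerZ a u v : inner (a *: u) v = a * inner u v :> R.
  rewrite innerC -[a *: u]addr0 inner_scalar.
  have -> : inner v 0 = 0 :> R.
    by have := inner_scalar v (-1) 0 0; rewrite scaler0 addr0 mulN1r addNr.
  by rewrite addr0 innerC.
have innerDr u v w : inner u (v + w) = inner u v + inner u w :> R.
  by rewrite -[v]scale1r inner_scalar scale1r mul1r.
have [->|y0] := eqVneq y 0.
  have -> : inner x 0 = 0 :> R.
    by have := inner_scalar x (-1) 0 0; rewrite scaler0 addr0 mulN1r addNr.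
  by rewrite !normr0 mulr0.
have ny : 0 < `|y| ^+ 2 by rewrite exprn_gt0// normr_gt0.
rewrite -ler_sqr ?nnegrE ?mulr_ge0// real_normK ?num_real// exprMn.
pose t : R := - (inner x y / `|y| ^+ 2).
have : 0 <= inner (t *: y + x) (t *: y + x) :> R.
  by rewrite inner_norm exprn_ge0.
rewrite innerDr [inner _ (t *: y)]innerC !innerZ innerDr.
rewrite [inner (_ + _) x]innerC innerDr [inner x (t *: y)]innerC innerZ.
rewrite [inner y (t *: y)]innerC innerZ !inner_norm [inner y x]innerC.
have -> : t * (t * `|y| ^+ 2 + inner x y) + (t * inner x y + `|x| ^+ 2) =
          `|x| ^+ 2 - inner x y ^+ 2 / `|y| ^+ 2.
  by rewrite /t; field; rewrite normr_eq0.
by rewrite subr_ge0 ler_pdivrMr.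
Qed.

Fact riesz_subproof (X : hilbertType R) (x : X) :
  (inner x : X -> R^o) \in @contlin_pred R X R^o.
Proof.
rewrite inE; have lx : linear (inner x : X -> R^o) by exact: inner_scalar.
split=> //.
pose f : {linear X -> R^o} := HB.pack (inner x : X -> R^o)
  (GRing.isLinear.Build R X R^o *:%R (inner x : X -> R^o) lx).
apply: (@bounded_linear_continuous R X R^o f).
apply/linear_boundedP; near=> r => y.
rewrite (le_trans (inner_le_norm x y))// ler_wpM2r//.
Unshelve. all: by end_near. Qed.

Definition riesz (X : hilbertType R) (x : X) : dual X :=
  ContLin (riesz_subproof x).

(* Riesz's theorem makes the set below a singleton. *)
Definition riesz_inv (X : hilbertType R) (g : dual X) : X :=
  xget 0 [set x | riesz x = g].

Fact swap_subproof (X Y : normedModType R) (T : contlin X (dual Y)) (y : Y) :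
  ((fun x => T x y) : X -> R^o) \in @contlin_pred R X R^o.
Proof.
rewrite inE; have lT : linear ((fun x => T x y) : X -> R^o).
  by move=> a u v; rewrite linearP.
split=> //.
pose f : {linear X -> R^o} := HB.pack ((fun x => T x y) : X -> R^o)
  (GRing.isLinear.Build R X R^o *:%R ((fun x => T x y) : X -> R^o) lT).
apply: (@bounded_linear_continuous R X R^o f).
apply/linear_boundedP; near=> r => x.
rewrite (le_trans (le_opnorm (T x) y))//.
rewrite (le_trans (ler_wpM2r (normr_ge0 y) (le_opnorm T x)))//.
rewrite mulrAC ler_wpM2r//.
Unshelve. all: by end_near. Qed.

(* For T : X -> Y', this is T^* : Y -> X' with Y identified with Y''. *)
Definition adjoint_dual (X Y : normedModType R) (T : contlin X (dual Y))
  (y : Y) : dual X := ContLin (swap_subproof T y).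

Definition transpose (X Y : normedModType R) (T : contlin X Y) (g : dual Y) :
  dual X := comp_contlin g T.
End hilbert.

Definition fin_dim_subspace (R : realType) (V : lmodType R) (A : set V) :=
  exists n (e : 'I_n -> V),
    A = [set v | exists c : 'I_n -> R, v = \sum_(i < n) c i *: e i].

Definition form_continuous (R : realType) (V : normedModType R)
    (a : V -> V -> R) :=
  exists M : R, forall v w, `|a v w| <= M * `|v| * `|w|.

Definition form_coercive (R : realType) (V : normedModType R)
    (a : V -> V -> R) :=
  exists2 c : R, 0 < c & forall v, c * `|v| ^+ 2 <= a v v.

Definition continuous_coercive_bilinear (R : realType) (V : normedModType R)
    (a : V -> V -> R) :=
  [/\ forall v, scalar (a v), forall w, scalar (a ^~ w),
      form_continuous a & form_coercive a].

(* With A = V this is the solution operator of a; the adjoint operators are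
   obtained by applying it to the form with swapped arguments. *)
Definition galerkin_operator (R : realType) (V : normedModType R)
    (a : V -> V -> R) (A : set V) (S : dual V -> V) :=
  forall g, A (S g) /\ forall v, A v -> a (S g) v = g v.

Definition projection (R : realType) (X : normedModType R) (A : set X) (x : X)
    : X :=
  xget 0 [set y | A y /\ forall z, A z -> `|x - y| <= `|x - z|].

Definition is_minimizer (X : Type) (disp : Order.disp_t) (T : porderType disp)
    (A : set X) (J : X -> T) (x : X) :=
  A x /\ forall y, A y -> (J x <= J y)%O.

(* What is used of a family of regular triangulations of a bounded domain:
   h_l is at most the diameter of the domain, and sup h_(l-1) / h_l is finite. *)
Definition mesh_sizes (R : realType) (h : nat -> R) :=
  [/\ forall l, 0 < h l, has_ubound (range h) &
      has_ubound [set h l / h l.+1 | l in [set: nat]]].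

Definition Lfun_all (d : measure_display) (T : measurableType d)
    (R : realType) (P : probability T R) (X : T -> R) :=
  forall q : R, 1 <= q -> X \in Lfun P q%:E.

Section bochner.
Context (R : realType) (d : measure_display) (T : measurableType d).
Context (P : probability T R) (X : normedModType R).
Implicit Types (f : T -> X) (s : nat -> {fimfun T >-> X}).

Definition simple_fun (g : {fimfun T >-> X}) :=
  forall x, measurable (g @^-1` [set x]).

Definition simple_integral (g : {fimfun T >-> X}) : X :=
  \sum_(x \in range g) fine (P (g @^-1` [set x])) *: x.

Definition strongly_measurable f :=
  exists2 s, (forall n, simple_fun (s n)) &
    {ae P, forall w, s ^~ w @ \oo --> f w}.

Definition is_bochner_integral f (m : X) :=
  strongly_measurable f /\
  exists s, [/\ forall n, simple_fun (s n),
    (fun n => (\int[P]_w (`|f w - s n w|)%:E)%E) @ \oo --> 0%E &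
    (fun n => simple_integral (s n)) @ \oo --> m].

Definition bochner_integrable f := exists m, is_bochner_integral f m.

Definition bochner_integral f : X := xget 0 (is_bochner_integral f).

(* Members are functions, and the norm vanishes only on functions that are 0
   almost everywhere: this covers spaces of genuine functions as well as spaces
   of classes modulo almost everywhere equality. *)
Record normed_fun_space := NormedFunSpace {
  fs_mem : (T -> X) -> Prop ;
  fs_norm : (T -> X) -> R ;
  fs_integrable : forall f, fs_mem f -> bochner_integrable f ;
  fs_mem0 : fs_mem (fun=> 0) ;
  fs_memP : forall (a : R) f g, fs_mem f -> fs_mem g ->
    fs_mem (fun w => a *: f w + g w) ;
  fs_normD : forall f g, fs_mem f -> fs_mem g ->
    fs_norm (fun w => f w + g w) <= fs_norm f + fs_norm g ;
  fs_normZ : forall (a : R) f, fs_mem f ->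
    fs_norm (fun w => a *: f w) = `|a| * fs_norm f ;
  fs_norm_eq0 : forall f, fs_mem f -> fs_norm f = 0 ->
    {ae P, forall w, f w = 0} }.

End bochner.

Section quadrature.
Context (R : realType) (d dq : measure_display).
Context (T : measurableType d) (TQ : measurableType dq).

(* The weights are deterministic; the nodes are random elements of T carried by
   the sampling space TQ. *)
Record quadrature := Quadrature {
  nnodes : nat ;
  weight : 'I_nnodes -> R ;
  weight_gt0 : forall j, 0 < weight j ;
  node : 'I_nnodes -> {mfun TQ >-> T} }.

Definition quad (X : lmodType R) (Q : quadrature) (w : TQ) (f : T -> X) : X :=
  \sum_(j < nnodes Q) weight j *: f (node j w).

Context (P : probability T R) (PQ : probability TQ R).

Definition unbiased (Q : quadrature) :=
  forall X : T -> R, X \in Lfun P 1 ->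
    ('E_PQ[fun w => quad Q w (X : T -> R^o)] = 'E_P[X])%E.

(* The sigma-algebra generated by the nodes of Q. *)
Definition node_sigma (Q : quadrature) : set (set TQ) :=
  <<s [set E | exists j A, measurable A /\ E = node (q := Q) j @^-1` A] >>.

Definition independent_quadratures (Q : nat -> quadrature) :=
  forall (I : seq nat) (E : nat -> set TQ), uniq I ->
    (forall k, k \in I -> node_sigma (Q k) (E k)) ->
    PQ (\bigcap_(k in [set` I]) E k) = (\prod_(k <- I) PQ (E k))%E.

Definition quadrature_assumption (Z : hilbertType R) (Q : nat -> quadrature)
    (gamma : nat -> R) (Hq : R -> normed_fun_space P Z) :=
  [/\ forall k, unbiased (Q k), independent_quadratures Q,
      nonincreasing_seq gamma /\ gamma @ \oo --> (0 : R) &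
      forall q : R, 2 <= q -> exists2 CQ : R, 0 < CQ &
        forall (f : T -> Z) (k : nat), fs_mem (Hq q) f ->
        ('N[PQ]_(q%:E)[(fun w => (`|bochner_integral P f - quad (Q k) w f|%R)%:E)]
           <= (CQ * gamma k * fs_norm (Hq q) f)%:E)%E ].

End quadrature.

Section control_problem.
Context (R : realType) (d : measure_display) (Om : measurableType d).
Context (P : probability Om R).
Context (V : completeNormedModType R) (Z W U H : hilbertType R).
Context (iZ : contlin V Z) (iW : contlin V W).
Context (B : contlin U (dual Z)) (C : contlin W H) (yd : H).
Implicit Types (S Sst : Om -> dual V -> V).

(* B u and C^* (riesz y), restricted to V along V -> Z and V -> W. *)
Definition control_load (u : U) : dual V := transpose iZ (B u).

Definition observation_load (y : H) : dual V :=
  transpose iW (transpose C (riesz y)).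

Definition observed_state S (u : U) (w : Om) : H :=
  C (iW (S w (control_load u))).

(* Takes its values in V, viewed in Z. *)
Definition adjoint_variable S Sst (u : U) (w : Om) : Z :=
  iZ (Sst w (observation_load (yd - observed_state S u w))).

Definition cost (nu : R) S (u : U) : \bar R :=
  ((2^-1)%:E * 'E_P[(fun w => `|observed_state S u w - yd| ^+ 2)%R]
   + (nu / 2 * `|u| ^+ 2)%:E)%E.

Definition quad_cost (dq : measure_display) (TQ : measurableType dq) (nu : R) S
    (Q : quadrature R Om TQ) (w' : TQ) (u : U) : R :=
  2^-1 * quad Q w' ((fun w => `|observed_state S u w - yd| ^+ 2) : Om -> R^o)
  + nu / 2 * `|u| ^+ 2.

(* [ulk l k] is the discrete optimal control for the space V_l and the
   formula Q k; terms with spatial index -1 are 0. *)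
Definition multilevel_control (dq : measure_display) (TQ : measurableType dq)
    (nu : R) (Uad : set U) (Sl Sstl : nat -> Om -> dual V -> V)
    (Q : nat -> quadrature R Om TQ) (ulk : nat -> nat -> TQ -> U)
    (L : nat) (w' : TQ) : U :=
  let p l k := adjoint_variable (Sl l) (Sstl l) (ulk l k w') in
  let p_prev l k := if l is l'.+1 then p l' k else fun=> 0 in
  projection Uad (nu^-1 *: riesz_inv (adjoint_dual B
    (\sum_(l < L.+1)
       quad (Q (L - l)%N) w' (fun w => p l (L - l)%N w - p_prev l (L - l)%N w)))).

(* The subspaces K and Kt of V carry their own norms and are given by continuous
   injections into V. *)
Definition finite_element_assumption (S Sst : Om -> dual V -> V)
    (Sl Sstl : nat -> Om -> dual V -> V) (h : nat -> R) (alphaW alphaZ : R) :=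
  (exists (K Kt : normedModType R) (iK : contlin K V) (iKt : contlin Kt V),
    [/\ injective iK, injective iKt &
        {ae P, forall w,
          (exists F : contlin U K, forall u, S w (control_load u) = iK (F u)) /\
          (exists F : contlin H Kt,
             forall y, Sst w (observation_load y) = iKt (F y))}]) /\
  (exists Ca Cast : Om -> R,
    [/\ forall w, 0 < Ca w /\ 0 < Cast w,
        Lfun_all P Ca, Lfun_all P Cast &
        {ae P, forall w,
          (forall l u,
             `|iW (S w (control_load u)) - iW (Sl l w (control_load u))|
               <= Ca w * h l `^ alphaW * `|u|) /\
          (forall l y,
             `|iZ (Sst w (observation_load y)) -
               iZ (Sstl l w (observation_load y))|
               <= Cast w * h l `^ alphaZ * `|y|)}]).

Definition mixed_regularity_assumption (S Sst : Om -> dual V -> V)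
    (Sl Sstl : nat -> Om -> dual V -> V) (h : nat -> R)
    (Hq : R -> normed_fun_space P Z) (ustar : U) (ulinf : nat -> U)
    (alphat : R) :=
  exists2 qbar : R, 2 < qbar & forall q : R, 2 <= q <= qbar ->
    [/\ forall u, fs_mem (Hq q) (adjoint_variable S Sst u),
        forall l u, fs_mem (Hq q) (adjoint_variable (Sl l) (Sstl l) u) &
        exists2 CH : R, 0 < CH & forall l,
          fs_norm (Hq q) (fun w => adjoint_variable S Sst ustar w -
                            adjoint_variable (Sl l) (Sstl l) (ulinf l) w)
            <= CH * h l `^ alphat * (`|ustar| + `|yd|)].

End control_problem.

(* Main.v *)
(** The first-order conditions of the discrete problems give
    nu u_{l,k} = B^* Q^k[p_l(u_{l,k})] (up to the Riesz isomorphism), so without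
    control constraints the multilevel control telescopes to
    sum_l (u_{l,L-l} - u_{l-1,L-l}). With e_l = u_{l,oo} - u_{l,k}, its error is
    (u* - u_{L,oo}) + sum_l (e_l - e_{l-1}), where k = L - l.

    Let A_l be the control-to-observation map of level l. Then e_l solves
    (nu + Q^k[A_l^* A_l]) e_l = B^* d_l, where d_l is the sampling error
    (E - Q^k)[p_l(u_{l,oo})]. Subtracting two levels and testing with
    e_l - e_{l-1} bounds nu |e_l - e_{l-1}| by |B| |d_l - d_{l-1}|, controlled by
    mixed regularity, plus Q^k[D] (h_l^a + h_{l-1}^a) |e_{l-1}|, where the random
    D, having moments of all orders, dominates A_l^* A_l - A^* A. Hoelder's
    inequality handles this product: d_{l-1} has a moment of order greater than
    2, and the moments of Q^k[D] are those of D at most, by Jensen and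
    unbiasedness.

    The solution operators and the sampled controls are not assumed measurable.
    The lower integral is monotone without measurability, so almost sure
    measurable majorants suffice; unbiasedness makes the nodes avoid null sets. *)

Require Import Defs.
From HB Require Import structures.
From mathcomp Require Import all_boot all_order all_algebra.
From mathcomp Require Import all_classical all_reals all_analysis.
From mathcomp Require Import measurable_realfun.
From mathcomp Require Import finmap.
From mathcomp Require Import ring lra.
Set Implicit Arguments.
Unset Strict Implicit.
Unset Printing Implicit Defensive.
Import Order.TTheory GRing.Theory Num.Theory.
Import numFieldNormedType.Exports.
Import HBNNSimple.
Local Open Scope classical_set_scope.
Local Open Scope ring_scope.

(** * Integrals of almost everywhere measurable functions *)

Section ae_integral.
Context d (T : measurableType d) (R : realType) (mu : {measure set T -> \bar R}).
Local Open Scope ereal_scope.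
Implicit Types f g : T -> \bar R.

(** The integral of a nonnegative function is a supremum over the nonnegative simple functions below
    it, a set that grows with the function; this covers non-measurable integrands. *)
Lemma ge0_le_integralT f g : (forall x, 0 <= f x) -> (forall x, f x <= g x) ->
  \int[mu]_x f x <= \int[mu]_x g x.
Proof.
move=> f0 fg; have g0 x : 0 <= g x by exact: le_trans (fg x).
rewrite !ge0_integralTE//; apply: ge_ereal_sup => _ [h /= hf <-].
apply: ereal_sup_ubound => /=; exists h => //= x.
by rewrite (le_trans _ (fg x)).
Qed.

(** Every simple function below [f] is almost everywhere below the measurable [g], so the usual
    comparison bounds its integral. *)
Lemma ae_le_integral_measurabler f g :
  (forall x, 0 <= f x) -> (forall x, 0 <= g x) -> measurable_fun setT g ->
  {ae mu, forall x, f x <= g x} -> \int[mu]_x f x <= \int[mu]_x g x.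
Proof.
move=> f0 g0 mg fg; rewrite ge0_integralTE//.
apply: ge_ereal_sup => _ [h /= hf <-].
rewrite -integralT_nnsfun; apply: ae_ge0_le_integral => //.
- by move=> x _; rewrite lee_fin.
- exact/measurable_EFinP.
- by apply: filterS fg => x fgx _; exact: le_trans (hf x) fgx.
Qed.

(** With a measurable minorant, the null set can be removed from the integral of [f]; what remains
    is below [g] everywhere. *)
Lemma ae_le_integral_measurablel f g :
  (forall x, 0 <= f x) -> (forall x, 0 <= g x) -> measurable_fun setT f ->
  {ae mu, forall x, f x <= g x} -> \int[mu]_x f x <= \int[mu]_x g x.
Proof.
move=> f0 g0 mf [N [mN N0 fgN]].
rewrite (ge0_negligible_integral mN)// integral_mkcond.
apply: ge0_le_integralT => x; rewrite patchE; case: ifPn => // xN.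
apply: contrapT => fgx; move/set_mem: xN => -[_]; apply.
exact: fgN.
Qed.

End ae_integral.

(** * Simple functions and almost everywhere limits *)

Section simple.
Context d (T : measurableType d).

(** Only fibres are asked to be measurable, so the target needs no sigma-algebra; pairs and
    arbitrary images of simple functions stay in the class. *)
Definition simple (X : Type) (f : T -> X) :=
  finite_set (range f) /\ forall x, measurable (f @^-1` [set x]).

Lemma simple_preimage (X : Type) (f : T -> X) (A : set X) :
  simple f -> measurable (f @^-1` A).
Proof.
move=> [ff mf].
rewrite [X in measurable X](_ : _ = \bigcup_(x in range f `&` A) f @^-1` [set x]).
  apply: fin_bigcup_measurable => //.
  exact: sub_finite_set ff.
apply/seteqP; split=> [w Afw|w [x [_ Ax] /= ->//]].
by exists (f w) => //; split => //; exists w.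
Qed.

Lemma simple_comp (X Y : Type) (f : T -> X) (h : X -> Y) :
  simple f -> simple (h \o f).
Proof.
move=> sf; split=> [|y]; last exact: (simple_preimage (h @^-1` [set y]) sf).
by rewrite -(image_comp f h setT); apply: finite_image; exact: sf.1.
Qed.

Lemma simple_pair (X Y : Type) (f : T -> X) (g : T -> Y) :
  simple f -> simple g -> simple (fun w => (f w, g w)).
Proof.
move=> [ff mf] [fg mg]; split.
  apply: (@sub_finite_set _ _ (range f `*` range g)); last exact: finite_setX.
  by move=> _ [w _ <-]; split; exists w.
move=> [x y].
rewrite [X in measurable X](_ : _ = f @^-1` [set x] `&` g @^-1` [set y]).
  exact: measurableI.
by apply/seteqP; split=> w /= [-> ->].
Qed.

Lemma simple_cst (X : Type) (x : X) : simple (cst x : T -> X).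
Proof.
split.
  by apply: (@sub_finite_set _ _ [set x]) => // _ [w _ <-].
by move=> y; rewrite preimage_cst; case: ifP.
Qed.

Lemma simple_sum (X : nmodType) (I : Type) (r : seq I) (f : I -> T -> X) :
  (forall i, simple (f i)) -> simple (fun w => \sum_(i <- r) f i w).
Proof.
move=> sf; elim: r => [|i r IHr].
  by under eq_fun do rewrite big_nil; exact: simple_cst.
under eq_fun do rewrite big_cons.
exact: (simple_comp (fun z => z.1 + z.2) (simple_pair (sf i) IHr)).
Qed.

Lemma simple_measurable (R : realType) (f : T -> R) :
  simple f -> measurable_fun setT f.
Proof. by move=> sf _ A mA; rewrite setTI; exact: simple_preimage. Qed.

Lemma simple_fun_simple (R : realType) (X : normedModType R)
  (f : {fimfun T >-> X}) : simple_fun f -> simple f.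
Proof. by move=> sf; split => //; exact: fimfunP. Qed.

End simple.

Lemma simple_node d d' (T : measurableType d) (T' : measurableType d')
  (X : Type) (f : T -> X) (h : T' -> T) :
  simple f -> measurable_fun setT h -> simple (f \o h).
Proof.
move=> [ff mf] mh; split.
  by apply: (sub_finite_set _ ff) => _ [w _ <-]; exists (h w).
by move=> x; rewrite -[X in measurable X]setTI; exact: (mh measurableT _ (mf x)).
Qed.

Section ae_limits.
Context d (T : measurableType d) (R : realType) (mu : {measure set T -> \bar R}).

(** Setting the limit to 0 on the exceptional null set turns it into an everywhere limit of
    measurable functions. *)
Lemma ae_cvg_measurable (f : nat -> T -> R) (g : T -> R) :
  (forall n, measurable_fun setT (f n)) ->
  {ae mu, forall w, f ^~ w @ \oo --> g w} ->
  exists2 g' : T -> R, measurable_fun setT g' & {ae mu, forall w, g w = g' w}.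
Proof.
move=> mf [N [mN N0 fgN]].
exists (g \_ (~` N)); last first.
  exists N; split => // w /= gw; apply: contrapT => Nw; apply: gw.
  by rewrite patchE mem_set.
apply/measurable_restrict => //; first exact: measurableC.
rewrite setTI.
apply: (@measurable_fun_cvg _ _ _ _ f) => [m|w Nw].
  exact: measurable_funS (mf m).
by apply: contrapT => fgw; apply: Nw; exact: fgN.
Qed.

Lemma complete_ae_measurable (f g : T -> R) : measure_is_complete mu ->
  {ae mu, forall w, f w = g w} -> measurable_fun setT g -> measurable_fun setT f.
Proof.
move=> cmu fg mg; apply/measurable_EFinP.
apply: (ae_measurable_fun cmu (f := EFin \o g)); last exact/measurable_EFinP.
by apply: filterS fg => w /= ->.
Qed.

End ae_limits.

(** * Functionals of Bochner integrals *)

(* Values of functionals in [R] instead of the convertible [R^o], so that the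
   lemmas on real-valued functions apply. *)
Definition pairing (R : realType) (X : normedModType R) (g : dual X) (x : X) : R :=
  g x.

Section bochner_functional.
Context (R : realType) (d : measure_display) (T : measurableType d).
Context (P : probability T R) (X : normedModType R).

Variable g : dual X.
Local Notation G := (pairing g).

Let GB x y : G (x - y) = G x - G y. Proof. exact: linearB. Qed.

Let GZ a x : G (a *: x) = a * G x. Proof. exact: linearZ. Qed.

Let Gsum (I : Type) (r : seq I) (F : I -> X) :
  G (\sum_(i <- r) F i) = \sum_(i <- r) G (F i).
Proof. exact: linear_sum. Qed.

Let Gc : continuous G. Proof. exact: (contlinP g).2. Qed.

(** A simple function is a finite sum of indicators of its fibres times its values, so both claims
    reduce to linearity. *)
Lemma simple_integral_functional (s : {fimfun T >-> X}) :
  simple_fun s ->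
  P.-integrable setT (fun w => (G (s w))%:E) /\
  (\int[P]_w (G (s w))%:E = (G (simple_integral P s))%:E)%E.
Proof.
move=> ss; pose r := fset_set (range s).
have gsE w : (G (s w))%:E = (\sum_(x <- r) (G x * \1_(s @^-1` [set x]) w)%:E)%E.
  rewrite sumEFin; congr (_%:E).
  rewrite (bigD1_seq (s w)) ?fset_uniq//=; last first.
    by rewrite /r in_fset_set//; apply/mem_set; exists w.
  rewrite indicE mem_set//= mulr1 big1 ?addr0// => x xs.
  by rewrite indicE memNset ?mulr0// => /= sx; rewrite sx eqxx in xs.
have ig x : P.-integrable setT (fun w => (G x * \1_(s @^-1` [set x]) w)%:E).
  under eq_fun do rewrite EFinM.
  by apply: integrableZl => //; apply: integrable_indic => //; exact: ss.
have gsF : (fun w => (G (s w))%:E) =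
    (fun w => \sum_(x <- r) (G x * \1_(s @^-1` [set x]) w)%:E)%E.
  exact/funext.
split; first by rewrite gsF; apply: integrable_sum => //.
rewrite gsF integral_sum//.
rewrite /simple_integral fsbig_finite//= Gsum -sumEFin.
apply: eq_bigr => x _.
under eq_integral do rewrite EFinM.
rewrite integralZl//; last by apply: integrable_indic => //; exact: ss.
rewrite integral_indic//.
rewrite setIT GZ EFinM muleC fineK// fin_num_measure//; exact: ss.
Qed.

Hypothesis P_complete : measure_is_complete P.

Lemma strongly_measurable_functional (h : X -> R) (f : T -> X) :
  continuous h -> strongly_measurable P f ->
  measurable_fun setT (fun w => h (f w)).
Proof.
move=> ch [s ss sf].
have [] := @ae_cvg_measurable _ T R P (fun n w => h (s n w)) (fun w => h (f w)).
- move=> n; apply: simple_measurable; apply: (simple_comp h).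
  exact: simple_fun_simple.
- by apply: filterS sf => w sw; apply: (cvg_comp _ _ sw); exact: ch.
by move=> g' mg' hg'; exact: complete_ae_measurable hg' mg'.
Qed.

Lemma strongly_measurable_norm_sub (f : T -> X) (t : {fimfun T >-> X}) :
  strongly_measurable P f -> simple_fun t ->
  measurable_fun setT (fun w => `|f w - t w|).
Proof.
move=> [s ss sf] st.
have [] := @ae_cvg_measurable _ T R P (fun n w => `|s n w - t w|)
    (fun w => `|f w - t w|).
- move=> n; apply: simple_measurable.
  apply: (@simple_comp _ _ _ _ (fun w => (s n w, t w))
    (fun z : X * X => `|z.1 - z.2|)).
  by apply: simple_pair; exact: simple_fun_simple.
- apply: filterS sf => w sw; apply: cvg_norm; apply: cvgB => //.
  exact: cvg_cst.
by move=> g' mg' hg'; exact: complete_ae_measurable hg' mg'.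
Qed.

(** Boundedness of the functional turns convergence in mean of the simple approximations into
    convergence of real integrals; continuity gives a second limit of the same sequence, and the two
    agree. *)
Lemma bochner_functional (f : T -> X) (m : X) :
  is_bochner_integral P f m ->
  P.-integrable setT (fun w => (G (f w))%:E) /\
  (\int[P]_w (G (f w))%:E = (G m)%:E)%E.
Proof.
move=> [smf [s [ss sf0 sm]]].
have [M M0 gM] := contlin_bounded g.
have cg : continuous G := Gc.
have mgf : measurable_fun setT (fun w => G (f w)).
  exact: (@strongly_measurable_functional (g : X -> R)).
have mfs n : measurable_fun setT (fun w => (`|f w - s n w|%R)%:E).
  by apply/measurable_EFinP; exact: strongly_measurable_norm_sub.
have [igs Igs] := all_and2 (fun n => simple_integral_functional (ss n)).
pose D n := (\int[P]_w (`|f w - s n w|%R)%:E)%E.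
have D0 n : (0 <= D n)%E by apply: integral_ge0 => w _; rewrite lee_fin.
have Dlt e : 0 < e -> \forall n \near \oo, (D n < e%:E)%E.
  move=> e0; have /fine_cvgP[fD Dc] := sf0.
  near=> n.
  have Dn : D n \is a fin_num by near: n.
  rewrite -(fineK Dn) lte_fin.
  by near: n; exact: (cvgr_lt _ Dc).
(* From [N] on the mean distance is below 1, hence finite: the difference to the simple function is
   integrable, and so is [G] composed with [f]. *)
have [N _ DN] := Dlt _ ltr01.
have Mlt n : (\int[P]_w (`|G (f w) - G (s n w)|%R)%:E <= M%:E * D n)%E.
  rewrite /D -ge0_integralZl//.
  apply: ge0_le_integralT => w.
    by rewrite lee_fin.
  by rewrite -EFinM lee_fin -GB; exact: gM.
have ifs n : (N <= n)%N -> P.-integrable setT (fun w => (G (f w) - G (s n w))%:E).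
  move=> Nn; apply/integrableP; split.
    apply/measurable_EFinP; apply: measurable_funB => //.
    by have /integrableP[/measurable_EFinP] := igs n.
  apply: (le_lt_trans (Mlt n)).
  apply: (@le_lt_trans _ _ M%:E); last exact: ltry.
  by rewrite -[leRHS]mule1 lee_wpmul2l// ltW//; exact: DN.
have igf : P.-integrable setT (fun w => (G (f w))%:E).
  have := integrableD measurableT (ifs N (leqnn _)) (igs N).
  by apply: eq_integrable => // w _ /=; rewrite -EFinD subrK.
split=> //.
have fIgf : (\int[P]_w (G (f w))%:E)%E \is a fin_num.
  exact: integrable_fin_num.
rewrite -(fineK fIgf); congr (_%:E).
pose I := fine (\int[P]_w (G (f w))%:E)%E.
have cI : (fun n => G (simple_integral P (s n)) : R) @ \oo --> (I : R).
  apply/cvgrPdist_le => e e0.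
  near=> n.
  have Nn : (N <= n)%N by near: n; exact: nbhs_infty_ge.
  have -> : I - G (simple_integral P (s n)) =
      fine (\int[P]_w (G (f w) - G (s n w))%:E)%E.
    transitivity (fine (I%:E - (G (simple_integral P (s n)))%:E)%E) => //.
    rewrite integralB_EFin//; last exact: igs.
    exact: (congr1 fine (f_equal2 (fun x y : \bar R => (x - y)%E)
      (fineK fIgf) (esym (Igs n)))).
  have fin_ifs := integrable_fin_num measurableT (ifs n Nn).
  rewrite -lee_fin -abse_EFin fineK//.
  apply: (le_trans (le_abse_integral _ _ _)) => //.
    by have /integrableP[] := ifs n Nn.
  apply: (le_trans (Mlt n)).
  (* Dividing by [M + 1] covers the case [M = 0]. *)
  have : (D n < (e / (M + 1))%:E)%E.
    by near: n; apply: Dlt; rewrite divr_gt0// ltr_wpDl.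
  move=> /ltW Dn; apply: (le_trans (lee_wpmul2l _ Dn)); first by rewrite lee_fin.
  rewrite -EFinM lee_fin mulrCA ler_piMr ?(ltW e0)//.
  by rewrite ler_pdivrMr ?mul1r ?lerDl// ltr_wpDl.
have cm : (fun n => G (simple_integral P (s n))) @ \oo --> G m.
  by apply: (cvg_comp _ _ sm); exact: cg.
exact: (cvg_unique _ cI cm).
Unshelve. all: by end_near. Qed.

End bochner_functional.

(** * Random quadrature formulae *)

Section quadrature_facts.
Context (R : realType) (d dq : measure_display).
Context (T : measurableType d) (TQ : measurableType dq).
Context (P : probability T R) (PQ : probability TQ R).
Variable Q : quadrature R T TQ.
Hypothesis Q_unbiased : unbiased P PQ Q.

Let Q_unbiased_int (X : T -> R) : P.-integrable setT (fun w => (X w)%:E) ->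
  (\int[PQ]_w' (quad Q w' (X : T -> R^o) : R)%:E = \int[P]_w (X w)%:E)%E.
Proof.
move=> /Lfun1_integrable /Q_unbiased; by rewrite unlock.
Qed.

Let quadE (X : T -> R) w' :
  quad Q w' (X : T -> R^o) = \sum_(j < nnodes Q) weight j * X (node j w') :> R.
Proof. by []. Qed.

(** This is unbiasedness for the constant function 1. *)
Lemma weight_sum1 : \sum_(j < nnodes Q) weight j = 1 :> R.
Proof.
have := Q_unbiased (Lfun_cst P 1 1).
rewrite expectation_cst.
rewrite (_ : (fun w' => _) = cst (\sum_(j < nnodes Q) weight j)); last first.
  by apply/funext => w'; rewrite quadE; under eq_bigr do rewrite mulr1.
by rewrite expectation_cst => -[].
Qed.

(** Unbiasedness for the indicator of [N] makes the mean of a sum of nonnegative terms vanish; one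
    of them is the indicator at node [j] times a positive weight. *)
Lemma node_null (N : set T) (j : 'I_(nnodes Q)) : measurable N -> P N = 0%E ->
  PQ (node j @^-1` N) = 0%E.
Proof.
move=> mN N0.
have mnN : measurable (node j @^-1` N) by exact: measurable_funPTI.
have := @Q_unbiased_int (\1_N) (integrable_indic _ mN).
have -> : (\int[P]_w (\1_N w)%:E = 0)%E by rewrite integral_indic// setIT.
move=> Q0.
have : ((weight j)%:E * PQ (node j @^-1` N) <= 0)%E.
  rewrite -[X in (_ * PQ X)%E]setIT -integral_indic// -ge0_integralZl//.
  - apply: (@le_trans _ _ (\int[PQ]_w' (quad Q w' (\1_N : T -> R^o) : R)%:E)%E);
      last by rewrite Q0.
    apply: ge0_le_integralT => w'.
      by rewrite mule_ge0// lee_fin// ltW// weight_gt0.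
    rewrite -EFinM lee_fin quadE (bigD1 j)//= lerDl sumr_ge0// => i _.
    by rewrite mulr_ge0// ltW// weight_gt0.
  - exact/measurable_EFinP.
  - by rewrite lee_fin ltW// weight_gt0.
move=> le0; apply/eqP; rewrite eq_le measure_ge0 andbT.
by rewrite -(lee_pmul2l (x := (weight j)%:E)) ?mule0// lte_fin weight_gt0.
Qed.

Lemma node_ae (A : T -> Prop) : {ae P, forall w, A w} ->
  {ae PQ, forall w' j, A (node (q := Q) j w')}.
Proof.
move=> [N [mN N0 AN]].
(* The node index is extended to all naturals, so that the countable intersection of almost sure
   events applies. *)
suff : {ae PQ, forall w' i (ji : (i < nnodes Q)%N),
    A (node (q := Q) (Ordinal ji) w')}.
  apply: filterS => w' + j => /(_ j (ltn_ord j)).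
  by congr (A (node _ w')); exact: val_inj.
apply: ae_foralln => i.
have [ji|ji] := pselect (i < nnodes Q)%N; last first.
  by apply: aeW => w' ji'; case: (ji ji').
exists (node (Ordinal ji) @^-1` N); split.
- exact: measurable_funPTI.
- exact: node_null.
- move=> w' /= /existsNP[ji' nA]; apply: AN => /= Aw; apply: nA.
  by rewrite (bool_irrelevance ji' ji).
Qed.

(** The nodes almost surely avoid the set where the simple approximations of [f] fail to converge,
    so the quadrature errors of these approximations converge to that of [f]. *)
Lemma quad_error_measurable (X : normedModType R) (f : T -> X) (z : X) :
  strongly_measurable P f ->
  exists2 g : TQ -> R, measurable_fun setT g &
    {ae PQ, forall w', `|z - quad Q w' f| = g w'}.
Proof.
move=> [s ss sf].
apply: (@ae_cvg_measurable _ TQ R PQ (fun n w' => `|z - quad Q w' (s n)|)).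
  move=> n; apply: simple_measurable.
  apply: (@simple_comp _ _ _ _ (fun w' => quad Q w' (s n)) (fun y => `|z - y|)).
  rewrite /quad; apply: simple_sum => j.
  apply: (@simple_comp _ _ _ _ (s n \o node j) (fun y => weight j *: y)).
  by apply: simple_node => //; exact: simple_fun_simple.
have := node_ae sf; apply: filterS => w' sw.
apply: cvg_norm; apply: cvgB; first exact: cvg_cst.
rewrite /quad; elim: (index_enum _) => [|j r IHr].
  by under eq_fun do rewrite big_nil; rewrite big_nil; exact: cvg_cst.
under eq_fun do rewrite big_cons; rewrite big_cons.
by apply: cvgD => //; apply: cvgZl_tmp; exact: sw.
Qed.

(** The weights sum to 1. Summing Young's inequality bounds the power of the mean [m] by the mean of
    powers over [p] plus the same power of [m] over [q]; the latter is absorbed since the exponents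
    are conjugate. *)
Lemma quad_jensen (X : T -> R) (p : R) w' : 1 <= p -> (forall w, 0 <= X w) ->
  (\sum_(j < nnodes Q) weight j * X (node j w')) `^ p <=
  \sum_(j < nnodes Q) weight j * X (node j w') `^ p.
Proof.
move=> p1 X0; set m := \sum_j _.
have m0 : 0 <= m by apply: sumr_ge0 => j _; rewrite mulr_ge0// ltW// weight_gt0.
have p0 : 0 < p by exact: lt_le_trans p1.
have [->|pn1] := eqVneq p 1.
  by rewrite powRr1//; under eq_bigr do rewrite powRr1//.
have {pn1}p1 : 1 < p by rewrite lt_neqAle eq_sym pn1.
have p10 : 0 < p - 1 by rewrite subr_gt0.
pose q := p / (p - 1).
have q0 : 0 < q by rewrite divr_gt0.
have pq : p^-1 + q^-1 = 1 by rewrite /q; field; rewrite !gt_eqF.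
(* Young's inequality applied to [X (node j w') * m `^ (p - 1)] *)
have young j : weight j * X (node j w') * m `^ (p - 1) <=
    weight j * (X (node (q := Q) j w') `^ p / p) + weight j * (m `^ p / q).
  rewrite -mulrDr -mulrA ler_wpM2l ?(ltW (weight_gt0 _))//.
  have := conjugate_powR (X0 (node j w')) (powR_ge0 m (p - 1)) p0 q0 pq.
  by rewrite -(powRrM m) (_ : (p - 1) * q = p)// /q; field; rewrite gt_eqF.
have : m `^ p <=
    (\sum_(j < nnodes Q) weight j * X (node j w') `^ p) / p + m `^ p / q.
  have mp : m `^ p = \sum_(j < nnodes Q) weight j * X (node j w') * m `^ (p - 1).
    rewrite -mulr_suml -/m.
    have [->|mn0] := eqVneq m 0; first by rewrite mul0r powR0 ?gt_eqF.
    by rewrite -[in X in X * _](powRr1 m0) -powRD ?mn0 ?implybT// addrC subrK.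
  rewrite {1}mp.
  apply: (le_trans (ler_sum _ (fun j _ => young j))).
  rewrite big_split/= -mulr_suml weight_sum1 mul1r. rewrite lerD2r mulr_suml.
  by apply: ler_sum => j _; rewrite mulrA.
rewrite -lerBlDr.
have -> : m `^ p - m `^ p / q = m `^ p / p.
  by rewrite -{1}(mulr1 (m `^ p)) -pq mulrDr addrK.
by rewrite ler_pM2r// invr_gt0.
Qed.

Lemma quad_moment_le (X : T -> R) (p : R) : 1 <= p -> (forall w, 0 <= X w) ->
  P.-integrable setT (fun w => (X w `^ p)%:E) ->
  (\int[PQ]_w' (((quad Q w' (X : T -> R^o) : R) `^ p)%:E)
     <= \int[P]_w (X w `^ p)%:E)%E.
Proof.
move=> p1 X0 iX; rewrite -Q_unbiased_int//.
apply: ge0_le_integralT => w'; first by rewrite lee_fin powR_ge0.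
by rewrite lee_fin !quadE; exact: quad_jensen.
Qed.

End quadrature_facts.

(** * Quadratic minimization *)

Section scalar_maps.
Context (R : realType) (X : lmodType R) (f : X -> R) (fL : scalar f).

Lemma scalarf0 : f 0 = 0.
Proof. by have := fL (-1) 0 0; rewrite scaler0 addr0 mulN1r addNr. Qed.

Lemma scalarfZ a x : f (a *: x) = a * f x.
Proof. by have := fL a x 0; rewrite !addr0 scalarf0 addr0. Qed.

Lemma scalarfD x y : f (x + y) = f x + f y.
Proof. by have := fL 1 x y; rewrite scale1r mul1r. Qed.

Lemma scalarfB x y : f (x - y) = f x - f y.
Proof. by rewrite scalarfD -scaleN1r scalarfZ mulN1r. Qed.

Lemma scalarf_sum (I : Type) (r : seq I) (F : I -> X) :
  f (\sum_(i <- r) F i) = \sum_(i <- r) f (F i).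
Proof.
elim: r => [|i r IHr]; first by rewrite !big_nil scalarf0.
by rewrite !big_cons scalarfD IHr.
Qed.

End scalar_maps.

Lemma quadratic_minimizer (R : realType) (X : lmodType R) (b : X -> X -> R)
    (l : X -> R) (u : X) :
  (forall x, scalar (b x)) -> (forall x y, b x y = b y x) -> scalar l ->
  (forall v, b u u / 2 - l u <= b v v / 2 - l v) -> forall v, b u v = l v.
Proof.
move=> bL bC lL umin v; apply/eqP; rewrite -subr_eq0; apply/negPn/negP => c0.
set c := b u v - l v in c0.
(* A step of size [- c / K] along [v] changes the functional by
   [- (c ^+ 2 / K ^+ 2) * (K - b v v / 2)]. This is negative, as [K] exceeds [b v v / 2] whatever
   the sign of [b v v]. *)
pose K := 1 + `|b v v|.
have K0 : 0 < K by rewrite ltr_wpDr.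
have := umin (u + (- c / K) *: v).
rewrite (scalarfD (bL _)) (scalarfZ (bL _)) ![b (u + _) _]bC.
rewrite !(scalarfD (bL _)) !(scalarfZ (bL _)) (scalarfD lL) (scalarfZ lL).
rewrite [b v u]bC -subr_ge0.
have -> : (b u u + - c / K * b u v + - c / K * (b u v + - c / K * b v v)) / 2 -
    (l u + - c / K * l v) - (b u u / 2 - l u) =
    - (c ^+ 2 / K ^+ 2) * (K - b v v / 2).
  by rewrite /c; field; rewrite gt_eqF.
rewrite leNgt => /negP; apply.
rewrite nmulr_rlt0; last first.
  by rewrite oppr_lt0 -expr_div_n exprn_even_gt0//= mulf_neq0// invr_neq0// gt_eqF.
have := ler_norm (b v v); have := normr_ge0 (b v v); rewrite /K; lra.
Qed.

Section pairing_theory.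
Context (R : realType).

Lemma pairing_scalar (X : normedModType R) (g : dual X) : scalar (pairing g).
Proof. by move=> a x y; rewrite /pairing linearP. Qed.

Lemma pairing_scalarl (X Y : normedModType R) (B : contlin X (dual Y)) (y : Y) :
  scalar (fun x => pairing (B x) y).
Proof. by move=> a u v; rewrite linearP. Qed.

Lemma pairing_le (X Y : normedModType R) (B : contlin X (dual Y)) x y :
  `|pairing (B x) y| <= opnorm B * `|y| * `|x|.
Proof.
rewrite mulrAC; apply: (le_trans (le_opnorm (B x) y)).
by rewrite ler_wpM2r//; exact: (le_opnorm B x).
Qed.

Lemma innerZl (X : hilbertType R) (x : X) a y :
  inner (a *: x) y = a * inner x y :> R.
Proof. by rewrite innerC (scalarfZ (inner_scalar _)) innerC. Qed.

Lemma innerBl (X : hilbertType R) (x y z : X) :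
  inner (x - y) z = inner x z - inner y z :> R.
Proof. by rewrite innerC (scalarfB (inner_scalar _)) ![inner z _]innerC. Qed.

Lemma inner_ext (X : hilbertType R) (x y : X) :
  (forall z, inner z x = inner z y :> R) -> x = y.
Proof.
move=> xy; apply/eqP; rewrite -subr_eq0 -normr_eq0 -sqrf_eq0 -inner_norm.
by rewrite (scalarfB (inner_scalar _)) xy subrr.
Qed.

Lemma riesz_inv_riesz (X : hilbertType R) (x : X) : riesz_inv (riesz x) = x.
Proof.
rewrite /riesz_inv; case: xgetP => [y _ /= yx|/(_ x)/=//].
apply: inner_ext => z; rewrite ![inner z _]innerC.
by rewrite -[LHS]/(riesz y z) yx.
Qed.

Lemma projectionT (X : normedModType R) (x : X) : projection setT x = x.
Proof.
rewrite /projection; case: xgetP => [y _ /= [_ /(_ x I)]|/(_ x)/=[]].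
  rewrite subrr normr0 normr_le0 subr_eq0 => /eqP.
  by [].
by split => // z _; rewrite subrr normr0.
Qed.

End pairing_theory.

(** * Averaged forms, optimality conditions and error equations *)

Section mean_forms.
Context (R : realType) (U Z : hilbertType R) (B : contlin U (dual Z)).
Implicit Types (m : U -> Z).

(* For [m u] an average of the adjoint variables [p u], this is the average of
   [inner (A u) (A v)], where [A] is the control-to-observation operator. *)
Definition mean_form m (u v : U) : R := pairing (B v) (m 0) - pairing (B v) (m u).

Definition psd_mean m :=
  (forall u v, mean_form m u v = mean_form m v u) /\
  forall u, 0 <= mean_form m u u.

Lemma mean_form_scalar m u : scalar (mean_form m u).
Proof.
move=> a v w; rewrite /mean_form !(pairing_scalarl B (_ : Z)).
by ring.
Qed.

Context (nu : R).

(** The first-order condition of the unconstrained problem, in weak form. *)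
Definition stationary m (u : U) :=
  forall v, nu * inner u v = pairing (B v) (m u) :> R.

(** The cost is half a quadratic form minus a linear one, up to the control-independent summand [c]
    that stems from the desired state. *)
Lemma minimizer_stationary m (u : U) (c : R) : psd_mean m ->
  (forall v, (mean_form m u u + nu * `|u| ^+ 2) / 2 - pairing (B u) (m 0) + c <=
             (mean_form m v v + nu * `|v| ^+ 2) / 2 - pairing (B v) (m 0) + c) ->
  stationary m u.
Proof.
move=> [mC _] umin v.
pose b x y := mean_form m x y + nu * inner x y.
have : b u v = pairing (B v) (m 0).
  apply: (@quadratic_minimizer _ _ b (fun v => pairing (B v) (m 0))).
  - move=> x a y z; rewrite /b mean_form_scalar inner_scalar; ring.
  - by move=> x y; rewrite /b mC innerC.
  - exact: pairing_scalarl.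
  - by move=> x; rewrite /b !inner_norm; have := umin x; rewrite lerD2r.
by rewrite /b /mean_form; lra.
Qed.

Definition solves m (e : U) (z : Z) :=
  forall v, nu * inner e v + mean_form m e v = pairing (B v) z :> R.

(** Tested with [B v], the map [m'] is affine in the control, so its change from [u'] to [u] moves
    to the left as a form term. On the right [m] and [m'] are compared at the same control [u]. *)
Lemma stationary_sub m m' u u' : psd_mean m' -> stationary m u -> stationary m' u' ->
  solves m' (u - u') (m u - m' u).
Proof.
move=> [mC _] mu mu' v.
rewrite innerBl mulrBr mu mu' mC (scalarfB (mean_form_scalar _ _)).
rewrite ![mean_form _ v _]mC.
by rewrite (scalarfB (pairing_scalar _)) /mean_form; ring.
Qed.

(** Testing with [e] itself, the nonnegative form term is dropped. Only the pairing of [z] with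
    [B e] has to be bounded, which is weaker than a bound on the norm of [z]. *)
Lemma solves_norm_le m e z (M : R) : psd_mean m -> solves m e z -> 0 <= M ->
  `|pairing (B e) z| <= M * `|e| -> nu * `|e| <= M.
Proof.
move=> [_ m0] me M0 ez; have [->|e0] := eqVneq e 0; first by rewrite normr0 mulr0.
have e1 : 0 < `|e| by rewrite normr_gt0.
rewrite -(ler_pM2r e1) -mulrA -expr2 -inner_norm (le_trans _ ez)//.
by rewrite -me (le_trans _ (ler_norm _))// lerDl.
Qed.

Lemma solves_norm_le_opnorm m e z : psd_mean m -> solves m e z ->
  nu * `|e| <= opnorm B * `|z|.
Proof.
move=> pm me; apply: solves_norm_le pm me _ (pairing_le _ _ _).
by rewrite mulr_ge0// opnorm_ge0.
Qed.

(** Subtract the equations and test with [e - e']: the form [m] of the difference is nonnegative,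
    and the change of form is only felt at [e']. *)
Lemma solves_sub_norm_le m m' e e' z z' (K : R) : psd_mean m -> psd_mean m' ->
  solves m e z -> solves m' e' z' -> 0 <= K ->
  (forall v, `|mean_form m e' v - mean_form m' e' v| <= K * `|v|) ->
  nu * `|e - e'| <= opnorm B * `|z - z'| + K.
Proof.
move=> [mC m0] pm' me me' K0 eK; have [d dE] : exists d, d = e - e' by eexists.
rewrite -dE.
have [->|d0] := eqVneq d 0.
  by rewrite normr0 mulr0 addr_ge0// mulr_ge0// opnorm_ge0.
have d1 : 0 < `|d| by rewrite normr_gt0.
rewrite -(ler_pM2r d1) -mulrA -expr2 -inner_norm.
have -> : nu * inner d d = pairing (B d) (z - z') -
    (mean_form m e' d - mean_form m' e' d) - mean_form m d d.
  have md : mean_form m d d = mean_form m e d - mean_form m e' d.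
    by rewrite mC {2}dE (scalarfB (mean_form_scalar _ _)) !(mC d).
  have := me d; have := me' d.
  have -> : nu * inner d d = nu * inner e d - nu * inner e' d.
    by rewrite {1}dE innerBl mulrBr.
  rewrite (scalarfB (pairing_scalar _)) md; lra.
rewrite mulrDl (le_trans (_ : _ <= pairing (B d) (z - z') -
    (mean_form m e' d - mean_form m' e' d)))//.
  by rewrite gerBl.
rewrite (le_trans (ler_norm _))// (le_trans (ler_normB _ _))// lerD//.
exact: pairing_le.
Qed.

End mean_forms.

(** * Optimality conditions of the control problem *)

Lemma complete_ae_integral (R : realType) (d : measure_display)
    (T : measurableType d) (P : probability T R) (f g : T -> R) :
  measure_is_complete P -> {ae P, forall w, f w = g w} ->
  P.-integrable setT (fun w => (g w)%:E) ->
  P.-integrable setT (fun w => (f w)%:E) /\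
  (\int[P]_w (f w)%:E = \int[P]_w (g w)%:E)%E.
Proof.
move=> cP fg ig; have /integrableP[/measurable_EFinP mg gy] := ig.
have mf : measurable_fun setT f by exact: complete_ae_measurable fg mg.
have fgE : {ae P, forall w, setT w -> (f w)%:E = (g w)%:E}.
  by apply: filterS fg => w ->.
split; last by apply: ae_eq_integral => //; exact/measurable_EFinP.
apply/integrableP; split; first exact/measurable_EFinP.
rewrite (@ae_eq_integral _ _ _ _ _ (fun w => `|(g w)%:E|)%E)//.
- by apply/measurable_EFinP; apply: measurableT_comp.
- by apply/measurable_EFinP; apply: measurableT_comp.
- by apply: filterS fg => w /= ->.
Qed.

Section control.
Context (R : realType) (d : measure_display) (Om : measurableType d).
Context (P : probability Om R).
Context (V : completeNormedModType R) (Z W U H : hilbertType R).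
Context (iZ : contlin V Z) (iW : contlin V W).
Context (B : contlin U (dual Z)) (C : contlin W H) (yd : H).
Implicit Types (S Sst : Om -> dual V -> V) (w : Om).

Local Notation obs S u w := (observed_state iZ iW B C S u w).
Local Notation adj S Sst u w := (adjoint_variable iZ iW B C yd S Sst u w).

(** The duality between the control-to-observation map and its adjoint, the common property of the
    exact and the Galerkin solution operators behind the optimality conditions. *)
Definition compatible S Sst w :=
  forall u y, inner y (obs S u w) =
    pairing (B u) (iZ (Sst w (observation_load iW C y))) :> R.

(* Testing each Galerkin equation with the solution of the other one. *)
Lemma galerkin_compatible (a : V -> V -> R) (A : set V) S Sst w :
  galerkin_operator a A (S w) -> galerkin_operator (fun v z => a z v) A (Sst w) ->
  compatible S Sst w.
Proof.
move=> GS GSst u y.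
have [AS aS] := GS (control_load iZ B u).
have [ASst aSst] := GSst (observation_load iW C y).
rewrite -[RHS]/(control_load iZ B u (Sst w (observation_load iW C y)) : R).
rewrite -[LHS]/(observation_load iW C y (S w (control_load iZ B u)) : R).
by rewrite -aS// -aSst.
Qed.

Section compatible_facts.
Variables (S Sst : Om -> dual V -> V) (w : Om).
Hypothesis cS : compatible S Sst w.

(** Linearity is read off the other side of the duality, where the control enters through the linear
    [B]. *)
Lemma obs_linear a u v : obs S (a *: u + v) w = a *: obs S u w + obs S v w.
Proof.
apply: inner_ext => y; rewrite inner_scalar !cS.
exact: (pairing_scalarl B).
Qed.

Lemma obs0 : obs S 0 w = 0.
Proof.
by have := obs_linear (-1) 0 0; rewrite scaler0 addr0 scaleN1r addNr.
Qed.

Lemma pairing_adj u v :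
  pairing (B v) (adj S Sst u w) = inner (yd - obs S u w) (obs S v w).
Proof. by rewrite cS. Qed.

Lemma pairing_adj_sub u v :
  pairing (B v) (adj S Sst 0 w) - pairing (B v) (adj S Sst u w) =
  inner (obs S u w) (obs S v w).
Proof. by rewrite !pairing_adj obs0 subr0 innerBl; ring. Qed.

Lemma sqr_obs_sub u : `|obs S u w - yd| ^+ 2 =
  `|yd| ^+ 2 - 2 * pairing (B u) (adj S Sst 0 w) + inner (obs S u w) (obs S u w).
Proof.
rewrite pairing_adj obs0 subr0 -!inner_norm (scalarfB (inner_scalar _)) !innerBl.
by rewrite [inner (obs S u w) yd]innerC; ring.
Qed.

End compatible_facts.

Section expectation_mean.
Hypothesis P_complete : measure_is_complete P.
Variables (S Sst : Om -> dual V -> V).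
Hypothesis cS : {ae P, forall w, compatible S Sst w}.
Hypothesis adj_int : forall u, bochner_integrable P (fun w => adj S Sst u w).

Definition mean_adj u : Z := bochner_integral P (fun w => adj S Sst u w).

Lemma mean_adjP u v :
  P.-integrable setT (fun w => (pairing (B v) (adj S Sst u w))%:E) /\
  (\int[P]_w (pairing (B v) (adj S Sst u w))%:E =
    (pairing (B v) (mean_adj u))%:E)%E.
Proof.
apply: bochner_functional => //.
by rewrite /mean_adj /bochner_integral; case: (adj_int u) => m; exact: xgetI.
Qed.

(** This identifies the abstract form of the averaged adjoint variable with the mean of the inner
    products of observed states, whence symmetry and positivity. *)
Lemma mean_adj_form u v :
  P.-integrable setT (fun w => (inner (obs S u w) (obs S v w))%:E) /\
  (\int[P]_w (inner (obs S u w) (obs S v w))%:E =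
    (mean_form B mean_adj u v)%:E)%E.
Proof.
have [i0 I0] := mean_adjP 0 v; have [iu Iu] := mean_adjP u v.
have [] := @complete_ae_integral _ _ _ P
  (fun w => inner (obs S u w) (obs S v w))
  (fun w => pairing (B v) (adj S Sst 0 w) - pairing (B v) (adj S Sst u w)).
- by [].
- by apply: filterS cS => w cw; rewrite (pairing_adj_sub cw).
- by have := integrableB measurableT i0 iu; apply: eq_integrable.
move=> ii ->; split => //.
by rewrite integralB_EFin// I0 Iu.
Qed.

Lemma mean_adj_psd : psd_mean B mean_adj.
Proof.
split=> [u v|u]; last first.
  rewrite -lee_fin -(mean_adj_form u u).2; apply: integral_ge0 => w _.
  by rewrite lee_fin inner_norm exprn_ge0.
apply: EFin_inj; rewrite -(mean_adj_form u v).2 -(mean_adj_form v u).2.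
by apply: eq_integral => w _; rewrite innerC.
Qed.

Lemma cost_mean (nu : R) u :
  cost P iZ iW B C yd nu S u =
  ((mean_form B mean_adj u u + nu * `|u| ^+ 2) / 2 - pairing (B u) (mean_adj 0) +
    `|yd| ^+ 2 / 2)%:E.
Proof.
have [i0 I0] := mean_adjP 0 u; have [iu Iu] := mean_adj_form u u.
rewrite /cost.
have -> : ('E_P[(fun w => `|obs S u w - yd| ^+ 2)%R] = (`|yd| ^+ 2 -
    2 * pairing (B u) (mean_adj 0) + mean_form B mean_adj u u)%:E)%E.
  rewrite unlock.
  have ic : P.-integrable setT (fun w => (`|yd| ^+ 2)%:E).
    exact: finite_measure_integrable_cst.
  have i02 := integrableZl measurableT 2 i0.
  have icB : P.-integrable setT (fun w =>
      (`|yd| ^+ 2 - 2 * pairing (B u) (adj S Sst 0 w))%:E).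
    by have := integrableB measurableT ic i02; apply: eq_integrable.
  have [] := @complete_ae_integral _ _ _ P (fun w => `|obs S u w - yd| ^+ 2)
    (fun w => `|yd| ^+ 2 - 2 * pairing (B u) (adj S Sst 0 w) +
      inner (obs S u w) (obs S u w)).
  - by [].
  - by apply: filterS cS => w cw; rewrite (sqr_obs_sub cw).
  - by have := integrableD measurableT icB iu; apply: eq_integrable.
  move=> _ ->; rewrite integralD_EFin// Iu integralB_EFin//.
  have -> : (\int[P]_w (2 * pairing (B u) (adj S Sst 0 w))%:E =
      (2 * pairing (B u) (mean_adj 0))%:E)%E.
    under eq_integral do rewrite EFinM.
    by rewrite integralZl// I0.
  have -> // : (\int[P]_w (`|yd| ^+ 2)%:E = (`|yd| ^+ 2)%:E)%E.
  by rewrite -[RHS]mule1 -(probability_setT P); exact: integral_cst.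
by rewrite -EFinM -EFinD; congr (_%:E); field.
Qed.

Lemma cost_minimizer_stationary (nu : R) u :
  is_minimizer setT (cost P iZ iW B C yd nu S) u -> stationary B nu mean_adj u.
Proof.
move=> [_ umin].
apply: (minimizer_stationary (c := `|yd| ^+ 2 / 2) mean_adj_psd) => v.
by have := umin v I; rewrite !cost_mean lee_fin.
Qed.

End expectation_mean.

Section quadrature_mean.
Context (dq : measure_display) (TQ : measurableType dq).
Variables (Q : quadrature R Om TQ) (w' : TQ).
Variables (S Sst : Om -> dual V -> V).
Hypothesis cS : forall j, compatible S Sst (node (q := Q) j w').

Definition quad_adj u : Z := quad Q w' (fun w => adj S Sst u w).

Lemma pairing_quad v (f : Om -> Z) : pairing (B v) (quad Q w' f) =
  \sum_(j < nnodes Q) weight j * pairing (B v) (f (node j w')).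
Proof.
rewrite /quad (scalarf_sum (pairing_scalar _)); apply: eq_bigr => j _.
by rewrite (scalarfZ (pairing_scalar _)).
Qed.

Lemma quad_adj_form u v : mean_form B quad_adj u v =
  \sum_(j < nnodes Q)
    weight j * inner (obs S u (node j w')) (obs S v (node j w')).
Proof.
rewrite /mean_form /quad_adj !pairing_quad -sumrB; apply: eq_bigr => j _.
by rewrite -mulrBr (pairing_adj_sub (cS j)).
Qed.

Lemma quad_adj_psd : psd_mean B quad_adj.
Proof.
split=> [u v|u]; rewrite !quad_adj_form.
  by apply: eq_bigr => j _; rewrite innerC.
by apply: sumr_ge0 => j _; rewrite inner_norm mulr_ge0 ?exprn_ge0// ltW// weight_gt0.
Qed.

(** The sample is fixed, so the constant keeps the sum of the weights; it does not affect the
    minimizers. *)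
Lemma quad_cost_mean (nu : R) u :
  quad_cost iZ iW B C yd nu S Q w' u =
  (mean_form B quad_adj u u + nu * `|u| ^+ 2) / 2 - pairing (B u) (quad_adj 0) +
    (\sum_(j < nnodes Q) weight (q := Q) j * `|yd| ^+ 2) / 2.
Proof.
rewrite /quad_cost.
have -> : quad Q w' ((fun w => `|obs S u w - yd| ^+ 2) : Om -> R^o) =
    \sum_(j < nnodes Q) weight (q := Q) j * `|yd| ^+ 2 -
    2 * pairing (B u) (quad_adj 0) + mean_form B quad_adj u u.
  rewrite /quad quad_adj_form pairing_quad mulr_sumr -sumrB -big_split/=.
  apply: eq_bigr => j _; rewrite (sqr_obs_sub (cS j)) -[_ *: _]/(_ * _).
  ring.
by field.
Qed.

Lemma quad_cost_minimizer_stationary (nu : R) u :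
  is_minimizer setT (quad_cost iZ iW B C yd nu S Q w') u ->
  stationary B nu quad_adj u.
Proof.
move=> [_ umin].
apply: (minimizer_stationary quad_adj_psd) => v.
by have := umin v I; rewrite !quad_cost_mean; exact.
Qed.

End quadrature_mean.
End control.

(** * Discretization error *)

Lemma inner_ler (R : realType) (X : hilbertType R) (x y : X) (a b : R) :
  `|x| <= a -> `|y| <= b -> `|inner x y| <= a * b.
Proof.
by move=> xa yb; apply: (le_trans (inner_le_norm x y)); rewrite ler_pM.
Qed.

Section discretization_error.
Context (R : realType) (d : measure_display) (Om : measurableType d).
Context (P : probability Om R).
Context (V : completeNormedModType R) (Z W U H : hilbertType R).
Context (iZ : contlin V Z) (iW : contlin V W).
Context (B : contlin U (dual Z)) (C : contlin W H) (yd : H).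

Local Notation obs S u w := (observed_state iZ iW B C S u w).
Local Notation adj S Sst u w := (adjoint_variable iZ iW B C yd S Sst u w).

(** The deterministic factor of all bounds on observed states below; the random factor is
    [|cS| + ca + 1]. Here [hmax] bounds the factors [hl], which are later powers of mesh sizes. *)
Definition obs_const (hmax : R) : R :=
  (1 + opnorm C) * (1 + opnorm iW * (opnorm B * opnorm iZ) + hmax).

(** The first summand serves the two halves of the form error, the second one the data error. *)
Definition form_const (hmax : R) : R :=
  2 * obs_const hmax ^+ 2 + obs_const hmax * `|yd|.

Lemma control_load_le u : `|control_load iZ B u| <= opnorm B * opnorm iZ * `|u|.
Proof.
apply: opnorm_le => v v1; rewrite /=.
apply: (le_trans (pairing_le B u (iZ v))).
rewrite -[leRHS]mulrA [opnorm iZ * _]mulrC mulrA -[leRHS]mulrA.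
rewrite -mulrA ler_wpM2l ?opnorm_ge0// mulrC ler_wpM2l//.
by rewrite (le_trans (le_opnorm iZ v))// ler_piMr// opnorm_ge0.
Qed.

Section pointwise.
Variables (S Sl : Om -> dual V -> V) (w : Om) (cS ca hl hmax : R).
Hypothesis S_le : forall g : dual V, `|S w g| <= cS * `|g|.
Hypothesis Sl_error : forall u,
  `|iW (S w (control_load iZ B u)) - iW (Sl w (control_load iZ B u))|
    <= ca * hl * `|u|.
Hypotheses (ca0 : 0 <= ca) (hl0 : 0 <= hl) (hlmax : hl <= hmax).

Local Notation x := (`|cS| + ca + 1).
Local Notation k := (obs_const hmax).
Local Notation c1 := (opnorm iW * (opnorm B * opnorm iZ)).

Let c10 : 0 <= c1. Proof. by rewrite !mulr_ge0 ?opnorm_ge0. Qed.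

Let hmax0 : 0 <= hmax. Proof. exact: le_trans hlmax. Qed.

Let x1 : 1 <= x. Proof. by rewrite lerDr addr_ge0. Qed.

Let k0 : 0 <= k.
Proof.
by rewrite /obs_const mulr_ge0// ?addr_ge0// opnorm_ge0.
Qed.

Let obs_le_aux u : `|obs S u w| <= opnorm C * (c1 * `|cS| * `|u|).
Proof.
rewrite /observed_state; apply: (le_trans (le_opnorm C _)).
rewrite ler_wpM2l ?opnorm_ge0//; apply: (le_trans (le_opnorm iW _)).
rewrite -!mulrA ler_wpM2l ?opnorm_ge0//; apply: (le_trans (S_le _)).
apply: (@le_trans _ _ (`|cS| * `|control_load iZ B u|)).
  by rewrite ler_wpM2r// ler_norm.
have := control_load_le u => /(ler_wpM2l (normr_ge0 cS)) /le_trans; apply.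
by rewrite le_eqVlt; apply/orP; left; apply/eqP; ring.
Qed.

Let obs_sub_aux u : `|obs S u w - obs Sl u w| <= opnorm C * (ca * hl * `|u|).
Proof.
rewrite /observed_state -linearB -linearB; apply: (le_trans (le_opnorm C _)).
by rewrite ler_wpM2l ?opnorm_ge0// linearB; exact: Sl_error.
Qed.

Let C0 : 0 <= opnorm C. Proof. exact: opnorm_ge0. Qed.

Let const_le (y z : R) : 0 <= y -> y <= 1 + c1 + hmax -> 0 <= z -> z <= x ->
  opnorm C * (y * z) <= k * x.
Proof.
move=> y0 yc z0 zx; rewrite /obs_const -mulrA.
by rewrite ler_pM// ?mulr_ge0// ?lerDr// ler_pM.
Qed.

Lemma obs_le u : `|obs S u w| <= k * x * `|u|.
Proof.
apply: (le_trans (obs_le_aux u)); rewrite mulrA ler_wpM2r//.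
apply: const_le => //; first by rewrite -addrA addrCA lerDl addr_ge0.
by rewrite -addrA lerDl addr_ge0.
Qed.

Lemma obs_sub_le u : `|obs S u w - obs Sl u w| <= k * x * hl * `|u|.
Proof.
apply: (le_trans (obs_sub_aux u)); rewrite !mulrA ler_wpM2r// ler_wpM2r//.
rewrite -[X in _ * X <= _]mul1r; apply: const_le => //.
  by rewrite -addrA lerDl addr_ge0.
by rewrite -addrA [X in _ + X]addrC addrA lerDr addr_ge0// addr_ge0.
Qed.

(** Stability of the discrete operator is inherited from [S] through the discretization error,
    because [hl] is at most [hmax]. *)
Lemma obs_discrete_le u : `|obs Sl u w| <= k * x * `|u|.
Proof.
have -> : obs Sl u w = obs S u w - (obs S u w - obs Sl u w).
  by rewrite opprB addrC subrK.
apply: (le_trans (ler_normB _ _)).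
apply: (le_trans (lerD (obs_le_aux u) (obs_sub_aux u))).
rewrite -mulrDr -mulrDl mulrA ler_wpM2r//.
apply: (@le_trans _ _ (opnorm C * ((1 + c1 + hmax) * (`|cS| + ca)))).
  rewrite ler_wpM2l//.
  have a1 : c1 * `|cS| <= (1 + c1 + hmax) * `|cS|.
    by rewrite ler_wpM2r// -addrA addrCA lerDl addr_ge0.
  have a2 : ca * hl <= (1 + c1 + hmax) * ca.
    by rewrite mulrC ler_wpM2r// (le_trans hlmax)// lerDr addr_ge0.
  by rewrite mulrDr lerD.
apply: const_le => //; rewrite ?addr_ge0//.
by rewrite lerDl.
Qed.

(** Change one argument of the inner product at a time; each half is a state bound times a
    discretization error. *)
Lemma form_sub_le u v :
  `|inner (obs S u w) (obs S v w) - inner (obs Sl u w) (obs Sl v w) : R| <=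
  form_const hmax * x ^+ 2 * hl * `|u| * `|v|.
Proof.
have -> : inner (obs S u w) (obs S v w) - inner (obs Sl u w) (obs Sl v w) =
    inner (obs S u w - obs Sl u w) (obs S v w) +
    inner (obs Sl u w) (obs S v w - obs Sl v w) :> R.
  by rewrite innerBl (scalarfB (inner_scalar _)); ring.
apply: (le_trans (ler_normD _ _)).
apply: (le_trans (lerD (inner_ler (obs_sub_le u) (obs_le v))
  (inner_ler (obs_discrete_le u) (obs_sub_le v)))).
rewrite /form_const -subr_ge0.
rewrite [X in 0 <= X](_ : _ = k * `|yd| * x ^+ 2 * hl * `|u| * `|v|); last by ring.
have x0 : 0 <= x by exact: le_trans x1.
do 3 (apply: mulr_ge0 => //).
by apply: mulr_ge0; [exact: mulr_ge0|exact: exprn_ge0].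
Qed.

(** The bound is first order in the random factor, which is at least 1 and hence at most its
    square. *)
Lemma data_sub_le v :
  `|inner yd (obs S v w) - inner yd (obs Sl v w) : R| <=
  form_const hmax * x ^+ 2 * hl * `|v|.
Proof.
rewrite -(scalarfB (inner_scalar _)).
apply: (le_trans (inner_ler (lexx _) (obs_sub_le v))).
rewrite /form_const -subr_ge0.
rewrite [X in 0 <= X](_ : _ = (2 * k ^+ 2 * x ^+ 2 + k * `|yd| * (x * (x - 1))) *
  hl * `|v|); last by ring.
have x0 : 0 <= x by exact: le_trans x1.
do 2 (apply: mulr_ge0 => //); apply: addr_ge0; apply: mulr_ge0.
- by apply: mulr_ge0 => //; exact: exprn_ge0.
- exact: exprn_ge0.
- exact: mulr_ge0.
- by apply: mulr_ge0 => //; rewrite subr_ge0.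
Qed.

End pointwise.

Section averaged.
Hypothesis P_complete : measure_is_complete P.
Variables (CS Ca : Om -> R) (hmax : R).

Definition error_density w : R :=
  form_const hmax * (`|CS w| + Ca w + 1) ^+ 2.

Hypothesis hmax0 : 0 <= hmax.

Lemma form_const_ge0 : 0 <= form_const hmax.
Proof.
have k0 : 0 <= obs_const hmax.
  by rewrite mulr_ge0// ?addr_ge0// ?mulr_ge0// opnorm_ge0.
by rewrite addr_ge0// mulr_ge0// exprn_ge0.
Qed.

Lemma error_density_ge0 w : 0 <= error_density w.
Proof. by rewrite mulr_ge0 ?form_const_ge0// exprn_even_ge0. Qed.

Hypothesis Ca0 : forall w, 0 < Ca w.

Definition accurate S Sl hl w :=
  (forall g : dual V, `|S w g| <= CS w * `|g|) /\
  (forall u, `|iW (S w (control_load iZ B u)) - iW (Sl w (control_load iZ B u))|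
    <= Ca w * hl * `|u|).

(** By duality both pairings become inner products of observed states. The data error yields the
    summand 1 and the form error the summand with the norm of [u]; then integrate. *)
Lemma mean_adj_sub_le S Sst Sl Sstl hl u v :
  {ae P, forall w, compatible iZ iW B C S Sst w} ->
  {ae P, forall w, compatible iZ iW B C Sl Sstl w} ->
  {ae P, forall w, accurate S Sl hl w} ->
  (forall u, bochner_integrable P (fun w => adj S Sst u w)) ->
  (forall u, bochner_integrable P (fun w => adj Sl Sstl u w)) ->
  0 <= hl -> hl <= hmax ->
  P.-integrable setT (fun w => (error_density w)%:E) ->
  `|pairing (B v) (mean_adj P iZ iW B C yd S Sst u -
                   mean_adj P iZ iW B C yd Sl Sstl u)| <=
  fine (\int[P]_w (error_density w)%:E) * hl * (1 + `|u|) * `|v|.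
Proof.
move=> cS cSl acc iS iSl hl0 hlmax iD.
have [i1 I1] := mean_adjP P_complete iS u v.
have [i2 I2] := mean_adjP P_complete iSl u v.
rewrite (scalarfB (pairing_scalar _)) -lee_fin -abse_EFin EFinB -I1 -I2.
rewrite -integralB_EFin//.
have ii : P.-integrable setT (fun w => (pairing (B v) (adj S Sst u w) -
    pairing (B v) (adj Sl Sstl u w))%:E).
  by have := integrableB measurableT i1 i2; apply: eq_integrable.
apply: (le_trans (le_abse_integral _ measurableT _)).
  by have /integrableP[] := ii.
have fD : (\int[P]_w (error_density w)%:E)%E \is a fin_num.
  exact: integrable_fin_num.
have c0 : 0 <= hl * ((1 + `|u|) * `|v|) by rewrite !mulr_ge0// addr_ge0.
rewrite -!mulrA EFinM fineK// muleC -ge0_integralZl//; last first.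
- by move=> w _; rewrite lee_fin error_density_ge0.
- by have /integrableP[] := iD.
apply: ae_le_integral_measurabler.
- by [].
- by move=> w; rewrite -EFinM lee_fin mulr_ge0// error_density_ge0.
- under eq_fun do rewrite -EFinM.
  apply/measurable_EFinP; apply: measurable_funM => //.
  by apply/measurable_EFinP; have /integrableP[] := iD.
near=> w.
have cw : compatible iZ iW B C S Sst w by near: w.
have clw : compatible iZ iW B C Sl Sstl w by near: w.
have [Sw aw] : accurate S Sl hl w by near: w.
rewrite abse_EFin -EFinM lee_fin (pairing_adj _ cw) (pairing_adj _ clw).
have -> : inner (yd - obs S u w) (obs S v w) - inner (yd - obs Sl u w) (obs Sl v w) =
    (inner yd (obs S v w) - inner yd (obs Sl v w)) -
    (inner (obs S u w) (obs S v w) - inner (obs Sl u w) (obs Sl v w)) :> R.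
  by rewrite !innerBl; ring.
apply: (le_trans (ler_normB _ _)).
apply: (le_trans (lerD (data_sub_le (CS w) aw (ltW (Ca0 w)) hl0 hlmax v)
  (form_sub_le Sw aw (ltW (Ca0 w)) hl0 hlmax u v))).
by rewrite le_eqVlt; apply/orP; left; apply/eqP; rewrite /error_density; ring.
Unshelve. all: by end_near. Qed.

(** Both discrete forms are compared with that of the exact [S] at every node, and the pointwise
    bounds are averaged. *)
Lemma quad_form_sub_le (dq : measure_display) (TQ : measurableType dq)
    (Q : quadrature R Om TQ) (w' : TQ) S S1 Sst1 S2 Sst2 h1 h2 u v :
  (forall j, compatible iZ iW B C S1 Sst1 (node (q := Q) j w')) ->
  (forall j, compatible iZ iW B C S2 Sst2 (node (q := Q) j w')) ->
  (forall j, accurate S S1 h1 (node (q := Q) j w')) ->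
  (forall j, accurate S S2 h2 (node (q := Q) j w')) ->
  0 <= h1 -> h1 <= hmax -> 0 <= h2 -> h2 <= hmax ->
  `|mean_form B (quad_adj iZ iW B C yd Q w' S1 Sst1) u v -
    mean_form B (quad_adj iZ iW B C yd Q w' S2 Sst2) u v| <=
  (quad Q w' (error_density : Om -> R^o) : R) * (h1 + h2) * `|u| * `|v|.
Proof.
move=> c1 c2 a1 a2 h10 h1m h20 h2m.
rewrite (quad_adj_form _ c1) (quad_adj_form _ c2) -sumrB /quad -!mulrA mulr_suml.
apply: (le_trans (ler_norm_sum _ _ _)); apply: ler_sum => j _.
have wj := weight_gt0 (q := Q) j.
rewrite -mulrBr normrM gtr0_norm// -[_ *: _]/(_ * _) -mulrA ler_pM2l//.
have [Sw aw1] := a1 j; have [_ aw2] := a2 j.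
set w := node j w' in Sw aw1 aw2 *.
have e1 := form_sub_le Sw aw1 (ltW (Ca0 w)) h10 h1m u v.
have e2 := form_sub_le Sw aw2 (ltW (Ca0 w)) h20 h2m u v.
have -> : inner (obs S1 u w) (obs S1 v w) - inner (obs S2 u w) (obs S2 v w) =
    (inner (obs S u w) (obs S v w) - inner (obs S2 u w) (obs S2 v w)) -
    (inner (obs S u w) (obs S v w) - inner (obs S1 u w) (obs S1 v w)) :> R by ring.
apply: (le_trans (ler_normB _ _)); apply: (le_trans (lerD e2 e1)).
by rewrite le_eqVlt; apply/orP; left; apply/eqP; rewrite /error_density; ring.
Qed.

End averaged.
End discretization_error.

(** * Moment estimates *)

(** Since mesh sizes may exceed 1, lowering an exponent costs a power of an upper bound [M]. *)
Lemma powR_le_scaled (R : realType) (x M a b : R) : 0 < x -> x <= M -> b <= a ->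
  x `^ a <= Num.max 1 M `^ (a - b) * x `^ b.
Proof.
move=> x0 xM ba.
have -> : x `^ a = x `^ (a - b) * x `^ b.
  by rewrite -powRD ?subrK// (gt_eqF x0) implybT.
rewrite ler_wpM2r ?powR_ge0// ge0_ler_powR ?subr_ge0// ?nnegrE.
- exact: ltW.
- by rewrite le_max ler01.
- by rewrite le_max xM orbT.
Qed.

Lemma bochner_integralP (R : realType) (d : measure_display)
    (T : measurableType d) (P : probability T R) (X : normedModType R) (f : T -> X) :
  bochner_integrable P f -> is_bochner_integral P f (bochner_integral P f).
Proof. by case=> m; exact: xgetI. Qed.

(** Testing with the functionals [riesz z] reduces the claim to linearity of the Lebesgue integral
    and pins down the chosen values. *)
Lemma bochner_integralB (R : realType) (d : measure_display)
    (T : measurableType d) (P : probability T R) (X : hilbertType R) (f g : T -> X) :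
  measure_is_complete P ->
  bochner_integrable P f -> bochner_integrable P g ->
  bochner_integrable P (fun w => f w - g w) ->
  bochner_integral P (fun w => f w - g w) =
  bochner_integral P f - bochner_integral P g.
Proof.
move=> cP /bochner_integralP bf /bochner_integralP bg /bochner_integralP bfg.
apply: inner_ext => z; apply: EFin_inj.
have [_ Ifg] := bochner_functional (riesz z) cP bfg.
have [i1 I1] := bochner_functional (riesz z) cP bf.
have [i2 I2] := bochner_functional (riesz z) cP bg.
rewrite (scalarfB (inner_scalar _)) EFinB -[LHS]Ifg -[X in (X - _)%E]I1.
rewrite -[X in (_ - X)%E]I2 -integralB_EFin//.
by apply: eq_integral => w _; rewrite (scalarfB (pairing_scalar _)).
Qed.

Section moments.
Context (R : realType) (d : measure_display) (T : measurableType d).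
Context (mu : {measure set T -> \bar R}).

(** [F] itself may fail to be measurable; the bound on its norm is passed to the measurable version
    [g]. *)
Lemma Lnorm_moment_le (F g : T -> R) (q N : R) : 0 < q -> 0 <= N ->
  measurable_fun setT g -> {ae mu, forall w, F w = g w} ->
  ('N[mu]_(q%:E)[(fun w => (F w)%:E)] <= N%:E)%E ->
  (\int[mu]_w (`|g w| `^ q)%:E <= (N `^ q)%:E)%E.
Proof.
move=> q0 N0 mg Fg NF.
apply: (@le_trans _ _ (\int[mu]_w (`|F w| `^ q)%:E)%E).
  apply: ae_le_integral_measurablel.
  - by move=> w; rewrite lee_fin powR_ge0.
  - by move=> w; rewrite lee_fin powR_ge0.
  - apply/measurable_EFinP; apply: (measurableT_comp (measurable_powR _)) => //.
    exact: measurableT_comp.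
  - by apply: filterS Fg => w ->.
have -> : (\int[mu]_w (`|F w| `^ q)%:E = \int[mu]_w (`|(F w)%:E| `^ q))%E by [].
rewrite -poweR_Lnorm ?gt_eqF// -poweR_EFin.
apply: gt0_ler_poweR => //.
- exact: ltW.
- by rewrite in_itv/= leey andbT Lnorm_ge0.
- by rewrite in_itv/= leey andbT lee_fin.
Qed.

Lemma hoelder_sqr (X Y : T -> R) (q M N : R) : 2 < q -> 0 <= M -> 0 <= N ->
  measurable_fun setT X -> measurable_fun setT Y ->
  (\int[mu]_w (`|X w| `^ (2 * (q / (q - 2))))%:E <= M%:E)%E ->
  (\int[mu]_w (`|Y w| `^ q)%:E <= (N `^ q)%:E)%E ->
  (\int[mu]_w (X w ^+ 2 * Y w ^+ 2)%:E <= (M `^ ((q - 2) / q) * N ^+ 2)%:E)%E.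
Proof.
move=> q2 M0 N0 mX mY iX iY.
have q0 : 0 < q by exact: lt_trans q2.
have q20 : 0 < q - 2 by rewrite subr_gt0.
(* Conjugate exponents chosen so that the square of [Y] needs exactly the moment of order [q]. *)
pose r := q / (q - 2); pose s := q / 2.
have r0 : 0 < r by rewrite divr_gt0.
have s0 : 0 < s by rewrite divr_gt0.
have rs : r^-1 + s^-1 = 1 by rewrite /r /s; field; rewrite !gt_eqF.
have mX2 : measurable_fun setT (fun w => X w ^+ 2) by exact: measurable_funX.
have mY2 : measurable_fun setT (fun w => Y w ^+ 2) by exact: measurable_funX.
have := hoelder mu mX2 mY2 r0 s0 rs.
rewrite Lnorm1.
have -> : (\int[mu]_x `|(EFin \o ((fun w => (X w ^+ 2)%R) \*
      (fun w => (Y w ^+ 2)%R))%R) x| =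
    \int[mu]_w (X w ^+ 2 * Y w ^+ 2)%R%:E)%E.
  by apply: eq_integral => w _ /=; rewrite ger0_norm// mulr_ge0// sqr_ge0.
move/le_trans; apply; rewrite [X in (_ <= X)%E]EFinM.
have nrm (Z : T -> R) (t p : R) : 0 < p -> 
    ('N[mu]_(p%:E)[(EFin \o (fun w => Z w ^+ 2)%R)] =
     (\int[mu]_w (`|Z w| `^ (2 * p))%:E) `^ p^-1)%E.
  move=> p0; rewrite unlock; congr (_ `^ _)%E; apply: eq_integral => w _ /=.
  by rewrite normrX powRrM powR_mulrn.
apply: lee_pmul; rewrite ?Lnorm_ge0//.
- rewrite nrm//.
  have -> : (M `^ ((q - 2) / q))%:E = (M%:E `^ r^-1)%E.
    by rewrite poweR_EFin /r invf_div.
  apply: gt0_ler_poweR; rewrite ?invr_ge0 ?(ltW r0)//.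
  + by rewrite in_itv/= leey andbT integral_ge0// => w _; rewrite lee_fin powR_ge0.
  + by rewrite in_itv/= leey andbT lee_fin.
- rewrite nrm//.
  have -> : (N ^+ 2)%:E = ((N `^ q)%:E `^ s^-1)%E.
    rewrite poweR_EFin -powRrM /s invf_div mulrC mulrVK ?unitfE ?gt_eqF//.
    by rewrite powR_mulrn.
  apply: gt0_ler_poweR; rewrite ?invr_ge0 ?(ltW s0)//.
  + by rewrite in_itv/= leey andbT integral_ge0// => w _; rewrite lee_fin powR_ge0.
  + by rewrite in_itv/= leey andbT lee_fin powR_ge0.
  + by rewrite /s mulrC divfK.
Qed.

End moments.

Section density_moments.
Context (R : realType) (d : measure_display) (T : measurableType d).
Context (P : probability T R).

Lemma Lfun_all_measurable (X : T -> R) : Lfun_all P X -> measurable_fun setT X.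
Proof. by move=> /(_ 1 (lexx _)) /sub_Lfun_mfun /set_mem. Qed.

Lemma sum_moment_integrable (X Y : T -> R) (q : R) : 1 <= q ->
  Lfun_all P X -> Lfun_all P Y ->
  P.-integrable setT (fun w => ((`|X w| + `|Y w| + 1) `^ q)%:E).
Proof.
move=> q1 LX LY; have q0 : 0 <= q by exact: le_trans q1.
have mX := Lfun_all_measurable LX; have mY := Lfun_all_measurable LY.
have iX := Lfun_integrable q1 (LX _ q1); have iY := Lfun_integrable q1 (LY _ q1).
have i1 : P.-integrable setT (fun w : T => (1 : R)%:E).
  exact: finite_measure_integrable_cst.
apply: (@le_integrable _ _ _ _ _ _ _
    (fun w => (3 `^ q * (`|X w| `^ q + `|Y w| `^ q + 1))%:E)) => //.
- apply/measurable_EFinP; apply: (measurableT_comp (measurable_powR _)).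
  apply: measurable_funD => //.
  by apply: measurable_funD; exact: measurableT_comp.
- move=> w _ /=; rewrite lee_fin (ger0_norm (powR_ge0 _ _)).
  apply: le_trans (ler_norm _).
  set x := `|X w|; set y := `|Y w|.
  (* The sum is at most three times the maximum, whose power is one of the three powers on the
     right. *)
  pose m := Num.max (Num.max x y) 1.
  have m0 : 0 <= m by rewrite le_max ler01 orbT.
  have x0 : 0 <= x by exact: normr_ge0.
  have y0 : 0 <= y by exact: normr_ge0.
  apply: (@le_trans _ _ ((3 * m) `^ q)).
    rewrite ge0_ler_powR ?nnegrE ?addr_ge0 ?mulr_ge0//.
    have xm : x <= m by rewrite !le_max lexx.
    have ym : y <= m by rewrite !le_max lexx orbT.
    have m1 : 1 <= m by rewrite !le_max lexx orbT.
    lra.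
  rewrite powRM// ler_wpM2l ?powR_ge0// /m.
  have px := powR_ge0 x q; have py := powR_ge0 y q.
  rewrite /Num.max; case: ifP => _; first by rewrite powR1; lra.
  by case: ifP => _; lra.
- under eq_fun do rewrite EFinM !EFinD.
  apply: integrableZl => //; apply: integrableD => //.
  exact: integrableD.
Qed.

End density_moments.

Lemma sqr_sum_le (R : realFieldType) (n : nat) (x : 'I_n -> R) :
  (\sum_(i < n) x i) ^+ 2 <= n%:R * \sum_(i < n) x i ^+ 2.
Proof.
elim: n x => [|n IHn] x; first by rewrite !big_ord0 expr0n mulr0.
rewrite !big_ord_recr/=.
have := IHn (fun i => x (widen_ord (leqnSn n) i)).
set s := \sum_(i < n) _; set t := \sum_(i < n) _; set y := x ord_max => st.
have t0 : 0 <= t by apply: sumr_ge0 => i _; exact: sqr_ge0.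
clearbody s t y.
(* The cross term is controlled by the square of [s - n%:R * y] and the induction hypothesis, after
   division by [n]; for [n = 0] the sum [s] vanishes. *)
have yst : 2 * (s * y) <= t + n%:R * y ^+ 2.
  have [n0|n0] := posnP n.
    have : s ^+ 2 = 0.
      by apply/eqP; rewrite eq_le sqr_ge0 andbT (le_trans st)// n0 mul0r.
    move/eqP; rewrite sqrf_eq0 => /eqP ->; rewrite mul0r mulr0.
    by rewrite addr_ge0// mulr_ge0// sqr_ge0.
  have n0' : 0 < n%:R :> R by rewrite ltr0n.
  rewrite -(ler_pM2l n0').
  have := sqr_ge0 (s - n%:R * y); rewrite sqrrB; nra.
rewrite -natr1; nra.
Qed.

(** The square of a sum is at most twice the sum of squares; Hoelder's inequality handles the
    product [D * F2]. The bound is on a measurable majorant [G], as [X] may fail to be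
    measurable. *)
Lemma combined_second_moment (R : realType) (d : measure_display)
    (T : measurableType d) (mu : {measure set T -> \bar R})
    (X D F1 F2 : T -> R) (b1 b2 q M N1 N2 : R) :
  2 < q -> 0 <= b1 -> 0 <= b2 -> 0 <= M -> 0 <= N1 -> 0 <= N2 ->
  measurable_fun setT D -> (forall w, 0 <= D w) ->
  (\int[mu]_w (D w `^ (2 * (q / (q - 2))))%:E <= M%:E)%E ->
  (exists2 g : T -> R, measurable_fun setT g & {ae mu, forall w, F1 w = g w}) ->
  (exists2 g : T -> R, measurable_fun setT g & {ae mu, forall w, F2 w = g w}) ->
  ('N[mu]_(2%:E)[(fun w => (F1 w)%:E)] <= N1%:E)%E ->
  ('N[mu]_(q%:E)[(fun w => (F2 w)%:E)] <= N2%:E)%E ->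
  {ae mu, forall w, 0 <= X w <= b1 * F1 w + b2 * (D w * F2 w)} ->
  exists G : T -> R, [/\ measurable_fun setT G, forall w, 0 <= G w,
    {ae mu, forall w, X w ^+ 2 <= G w} &
    (\int[mu]_w (G w)%:E <=
      (2 * b1 ^+ 2 * N1 ^+ 2 + 2 * b2 ^+ 2 * (M `^ ((q - 2) / q) * N2 ^+ 2))%:E)%E].
Proof.
move=> q2 b10 b20 M0 N10 N20 mD D0 iD [g1 mg1 Fg1] [g2 mg2 Fg2] NF1 NF2 XF.
have q0 : 0 < q by exact: lt_trans q2.
have ig1 := Lnorm_moment_le (ltr0Sn R 1) N10 mg1 Fg1 NF1.
have ig2 := Lnorm_moment_le q0 N20 mg2 Fg2 NF2.
have m1 : measurable_fun setT (fun w => g1 w ^+ 2) by exact: measurable_funX.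
have m2 : measurable_fun setT (fun w => D w ^+ 2 * g2 w ^+ 2).
  by apply: measurable_funM; exact: measurable_funX.
have c1 : 0 <= 2 * b1 ^+ 2 by rewrite mulr_ge0// sqr_ge0.
have c2 : 0 <= 2 * b2 ^+ 2 by rewrite mulr_ge0// sqr_ge0.
have p1 w : 0 <= g1 w ^+ 2 by exact: sqr_ge0.
have p2 w : 0 <= D w ^+ 2 * g2 w ^+ 2 by rewrite mulr_ge0// sqr_ge0.
exists (fun w => 2 * b1 ^+ 2 * g1 w ^+ 2 + 2 * b2 ^+ 2 * (D w ^+ 2 * g2 w ^+ 2)).
split.
- by apply: measurable_funD; apply: measurable_funM.
- by move=> w; rewrite addr_ge0// mulr_ge0.
- apply: filterS3 XF Fg1 Fg2 => w /andP[X0 Xle] <- <-.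
  have : X w ^+ 2 <= (b1 * F1 w + b2 * (D w * F2 w)) ^+ 2.
    by rewrite ler_sqr// nnegrE// (le_trans X0).
  have := sqr_ge0 (b1 * F1 w - b2 * (D w * F2 w)).
  rewrite sqrrB sqrrD !exprMn; lra.
under eq_integral do rewrite EFinD EFinM [(2 * b2 ^+ 2 * _)%:E]EFinM.
rewrite ge0_integralD//; first last.
- by apply/measurable_EFinP; exact: measurable_funM.
- by move=> w _; rewrite -EFinM lee_fin mulr_ge0.
- by apply/measurable_EFinP; exact: measurable_funM.
- by move=> w _; rewrite -EFinM lee_fin mulr_ge0.
rewrite !ge0_integralZl//; first last.
- by move=> w _; rewrite lee_fin.
- exact/measurable_EFinP.
- by move=> w _; rewrite lee_fin.
- exact/measurable_EFinP.
rewrite EFinD leeD//.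
- rewrite [X in (_ <= X)%E]EFinM lee_wpmul2l//.
  rewrite -powR_mulrn//; apply: le_trans ig1.
  apply: ge0_le_integralT => w; rewrite lee_fin//.
  by rewrite powR_mulrn// real_normK// num_real.
- rewrite [X in (_ <= X)%E]EFinM lee_wpmul2l//.
  apply: hoelder_sqr => //; apply: le_trans iD.
  apply: ge0_le_integralT => w; rewrite lee_fin ?powR_ge0//.
  by rewrite ger0_norm.
Qed.

Section error_density_moments.
Context (R : realType) (d : measure_display) (Om : measurableType d).
Context (P : probability Om R).
Context (V : completeNormedModType R) (Z W U H : hilbertType R).
Context (iZ : contlin V Z) (iW : contlin V W).
Context (B : contlin U (dual Z)) (C : contlin W H) (yd : H).
Context (CS Ca : Om -> R) (hmax : R).
Context (LCS : Lfun_all P CS) (LCa : Lfun_all P Ca).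
Context (Ca0 : forall w, 0 < Ca w) (hmax0 : 0 <= hmax).

Local Notation D := (error_density iZ iW B C yd CS Ca hmax).

(** The density is quadratic in the random constants, so its moment of order [r] is one of order
    [2 * r] of their sum. *)
Lemma error_density_moment (r : R) : 1 <= r ->
  P.-integrable setT (fun w => (D w `^ r)%:E).
Proof.
move=> r1; have k0 := form_const_ge0 iZ iW B C yd hmax0.
have DE w : D w `^ r = form_const iZ iW B C yd hmax `^ r *
    (`|CS w| + `|Ca w| + 1) `^ (2 * r).
  rewrite /error_density powRM ?sqr_ge0// (gtr0_norm (Ca0 w)).
  by rewrite powRrM powR_mulrn// !addr_ge0// (ltW (Ca0 w)).
have r2 : 1 <= 2 * r by rewrite (le_trans r1)// ler_peMl ?ler1n// (le_trans ler01).
have := integrableZl measurableT (form_const iZ iW B C yd hmax `^ r)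
  (sum_moment_integrable r2 LCS LCa).
by apply: eq_integrable => // w _; rewrite DE EFinM.
Qed.

Lemma error_density_measurable : measurable_fun setT D.
Proof.
have mCS := Lfun_all_measurable LCS; have mCa := Lfun_all_measurable LCa.
apply: measurable_funM => //; apply: measurable_funX.
apply: measurable_funD => //; apply: measurable_funD => //.
exact: measurableT_comp.
Qed.

Lemma error_density_integrable : P.-integrable setT (fun w => (D w)%:E).
Proof.
have := error_density_moment (lexx 1).
apply: eq_integrable => // w _ /=.
by rewrite powRr1//; exact: error_density_ge0.
Qed.

End error_density_moments.

Lemma quad_measurable (R : realType) (d dq : measure_display)
    (T : measurableType d) (TQ : measurableType dq) (Q : quadrature R T TQ)
    (X : T -> R) : measurable_fun setT X ->
  measurable_fun setT (fun w' => quad Q w' (X : T -> R^o) : R).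
Proof.
move=> mX; rewrite /quad.
apply: (@measurable_sum _ _ _ _ _ _ (fun j w' => weight j * X (node j w'))) => j.
by apply: measurable_funM => //; exact: measurableT_comp.
Qed.

(** * Sampling error of one level *)

Section normed_fun_space_theory.
Context (R : realType) (d : measure_display) (T : measurableType d).
Context (P : probability T R) (X : normedModType R) (F : normed_fun_space P X).

Lemma fs_memB f g : fs_mem F f -> fs_mem F g -> fs_mem F (fun w => f w - g w).
Proof.
move=> mf mg; rewrite (_ : (fun w => _) = (fun w => -1 *: g w + f w)).
  exact: fs_memP.
by apply/funext => w; rewrite scaleN1r addrC.
Qed.

Lemma fs_normB f g : fs_mem F f -> fs_mem F g ->
  fs_norm F (fun w => f w - g w) <= fs_norm F f + fs_norm F g.
Proof.
move=> mf mg.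
have mNg : fs_mem F (fun w => -1 *: g w).
  have := fs_memP (-1) mg (fs_mem0 F).
  rewrite (_ : (fun w => _) = (fun w => -1 *: g w))//.
  by apply/funext => w; rewrite addr0.
rewrite (_ : (fun w => f w - g w) = (fun w => f w + -1 *: g w)); last first.
  by apply/funext => w; rewrite scaleN1r.
by rewrite (le_trans (fs_normD mf mNg))// fs_normZ// normrN1 mul1r.
Qed.

End normed_fun_space_theory.

Lemma quadB (R : realType) (d dq : measure_display) (T : measurableType d)
    (TQ : measurableType dq) (X : lmodType R) (Q : quadrature R T TQ) (w' : TQ)
    (f g : T -> X) :
  quad Q w' (fun w => f w - g w) = quad Q w' f - quad Q w' g.
Proof.
by rewrite /quad -sumrB; apply: eq_bigr => j _; rewrite scalerBr.
Qed.

Section sampled_levels.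
Context (R : realType) (d dq : measure_display) (Om : measurableType d).
Context (P : probability Om R) (P_complete : measure_is_complete P).
Context (OmQ : measurableType dq) (PQ : probability OmQ R).
Context (V : completeNormedModType R) (Z W U H : hilbertType R).
Context (iZ : contlin V Z) (iW : contlin V W).
Context (B : contlin U (dual Z)) (C : contlin W H) (yd : H).
Context (nu : R) (nu_gt0 : 0 < nu) (Q : quadrature R Om OmQ).
Context (Q_unbiased : unbiased P PQ Q).

Local Notation adj S Sst u w := (adjoint_variable iZ iW B C yd S Sst u w).

Definition sampling_error (f : Om -> Z) (w' : OmQ) : R :=
  `|bochner_integral P f - quad Q w' f|.

Lemma quad_stationary_ae S1 Sst1 (u1 : OmQ -> U) :
  {ae P, forall w, compatible iZ iW B C S1 Sst1 w} ->
  {ae PQ, forall w',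
    is_minimizer setT (quad_cost iZ iW B C yd nu S1 Q w') (u1 w')} ->
  {ae PQ, forall w', psd_mean B (quad_adj iZ iW B C yd Q w' S1 Sst1) /\
    stationary B nu (quad_adj iZ iW B C yd Q w' S1 Sst1) (u1 w')}.
Proof.
move=> /(node_ae Q_unbiased) c1 m1; apply: filterS2 c1 m1 => w' c1 m1.
split; first exact: quad_adj_psd.
exact: quad_cost_minimizer_stationary.
Qed.

Lemma level_error_le S1 Sst1 (u1 : U) (v1 : OmQ -> U) :
  {ae P, forall w, compatible iZ iW B C S1 Sst1 w} ->
  stationary B nu (mean_adj P iZ iW B C yd S1 Sst1) u1 ->
  {ae PQ, forall w',
    is_minimizer setT (quad_cost iZ iW B C yd nu S1 Q w') (v1 w')} ->
  {ae PQ, forall w', `|u1 - v1 w'| <=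
    opnorm B / nu * sampling_error (fun w => adj S1 Sst1 u1 w) w'}.
Proof.
move=> c1 s1 /(quad_stationary_ae c1); apply: filterS => w' [p1 sv1].
have := solves_norm_le_opnorm p1 (stationary_sub p1 s1 sv1).
by rewrite mulrAC ler_pdivlMr// mulrC.
Qed.

(** The error equations of the two levels differ in data and in form. The change of form acts on the
    error [u2 - v2 w'] of the second level, which is again at most a multiple of a sampling
    error. *)
Lemma level_increment_le (CS Ca : Om -> R) hmax S S1 Sst1 S2 Sst2 h1 h2
    (u1 u2 : U) (v1 v2 : OmQ -> U) :
  (forall w, 0 < Ca w) -> 0 <= h1 -> h1 <= hmax -> 0 <= h2 -> h2 <= hmax ->
  {ae P, forall w, compatible iZ iW B C S1 Sst1 w} ->
  {ae P, forall w, compatible iZ iW B C S2 Sst2 w} ->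
  {ae P, forall w, accurate iZ iW B CS Ca S S1 h1 w} ->
  {ae P, forall w, accurate iZ iW B CS Ca S S2 h2 w} ->
  bochner_integrable P (fun w => adj S1 Sst1 u1 w) ->
  bochner_integrable P (fun w => adj S2 Sst2 u2 w) ->
  bochner_integrable P (fun w => adj S1 Sst1 u1 w - adj S2 Sst2 u2 w) ->
  stationary B nu (mean_adj P iZ iW B C yd S1 Sst1) u1 ->
  stationary B nu (mean_adj P iZ iW B C yd S2 Sst2) u2 ->
  {ae PQ, forall w',
    is_minimizer setT (quad_cost iZ iW B C yd nu S1 Q w') (v1 w')} ->
  {ae PQ, forall w',
    is_minimizer setT (quad_cost iZ iW B C yd nu S2 Q w') (v2 w')} ->
  {ae PQ, forall w', `|(u1 - v1 w') - (u2 - v2 w')| <=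
    opnorm B / nu *
      sampling_error (fun w => adj S1 Sst1 u1 w - adj S2 Sst2 u2 w) w' +
    (h1 + h2) * (opnorm B / nu ^+ 2) *
      ((quad Q w' (error_density iZ iW B C yd CS Ca hmax : Om -> R^o) : R) *
       sampling_error (fun w => adj S2 Sst2 u2 w) w')}.
Proof.
move=> Ca0 h10 h1m h20 h2m c1 c2 a1 a2 i1 i2 i12 s1 s2 m1 m2.
have q1 := quad_stationary_ae c1 m1; have q2 := quad_stationary_ae c2 m2.
have e2 := level_error_le c2 s2 m2.
have n1 := node_ae Q_unbiased c1; have n2 := node_ae Q_unbiased c2.
have na1 := node_ae Q_unbiased a1; have na2 := node_ae Q_unbiased a2.
near=> w'.
have [p1 sv1] : psd_mean B (quad_adj iZ iW B C yd Q w' S1 Sst1) /\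
    stationary B nu (quad_adj iZ iW B C yd Q w' S1 Sst1) (v1 w') by near: w'.
have [p2 sv2] : psd_mean B (quad_adj iZ iW B C yd Q w' S2 Sst2) /\
    stationary B nu (quad_adj iZ iW B C yd Q w' S2 Sst2) (v2 w') by near: w'.
have e2w : `|u2 - v2 w'| <=
    opnorm B / nu * sampling_error (fun w => adj S2 Sst2 u2 w) w' by near: w'.
pose qD : R := quad Q w' (error_density iZ iW B C yd CS Ca hmax : Om -> R^o).
have hmax0 : 0 <= hmax by exact: le_trans h1m.
have qD0 : 0 <= qD.
  apply: sumr_ge0 => j _; rewrite mulr_ge0 ?error_density_ge0// ltW//.
  exact: weight_gt0.
have K0 : 0 <= qD * (h1 + h2) * `|u2 - v2 w'| by rewrite !mulr_ge0// addr_ge0.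
have fK v : `|mean_form B (quad_adj iZ iW B C yd Q w' S1 Sst1) (u2 - v2 w') v -
    mean_form B (quad_adj iZ iW B C yd Q w' S2 Sst2) (u2 - v2 w') v| <=
    qD * (h1 + h2) * `|u2 - v2 w'| * `|v|.
  by apply: (@quad_form_sub_le _ _ _ _ _ _ _ _ _ _ _ _ _ CS Ca hmax Ca0
    _ _ Q w' S) => //; near: w'.
have := solves_sub_norm_le p1 p2 (stationary_sub p1 s1 sv1)
  (stationary_sub p2 s2 sv2) K0 fK.
(* By linearity of expectation and quadrature, the difference of the two sampling errors is the
   sampling error of the difference. *)
have -> : mean_adj P iZ iW B C yd S1 Sst1 u1 -
    quad_adj iZ iW B C yd Q w' S1 Sst1 u1 -
    (mean_adj P iZ iW B C yd S2 Sst2 u2 - quad_adj iZ iW B C yd Q w' S2 Sst2 u2) =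
    bochner_integral P (fun w => adj S1 Sst1 u1 w - adj S2 Sst2 u2 w) -
    quad Q w' (fun w => adj S1 Sst1 u1 w - adj S2 Sst2 u2 w).
  rewrite bochner_integralB// quadB /mean_adj /quad_adj !opprD !opprK !addrA.
  by congr (_ + _); exact: addrAC.
move=> le1; rewrite -(ler_pM2l nu_gt0); apply: (le_trans le1).
rewrite [leRHS]mulrDr -/qD; apply: lerD.
  rewrite le_eqVlt; apply/orP; left; apply/eqP.
  by rewrite /sampling_error; field; rewrite gt_eqF.
have := ler_wpM2l (mulr_ge0 qD0 (addr_ge0 h10 h20)) e2w.
move/le_trans; apply; rewrite le_eqVlt; apply/orP; left; apply/eqP.
by rewrite /sampling_error; field; rewrite gt_eqF.
Unshelve. all: by end_near. Qed.

End sampled_levels.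

(** * Summation of the level errors and choice of the constants *)

Theorem theorem4p8 (R : realType)
  (d : measure_display) (Om : measurableType d) (P : probability Om R)
  (P_complete : measure_is_complete P)
  (V : completeNormedModType R) (Z W U H : hilbertType R)
  (iZ : contlin V Z) (iW : contlin V W)
  (iZ_inj : injective iZ) (iZ_strict : range iZ `<` [set: Z])
  (iW_inj : injective iW) (iW_strict : range iW `<` [set: W])
  (a : Om -> V -> V -> R)
  (a_form : {ae P, forall w, continuous_coercive_bilinear (a w)})
  (S Sst : Om -> dual V -> V)
  (S_def : {ae P, forall w, galerkin_operator (a w) setT (S w)})
  (Sst_def :
     {ae P, forall w, galerkin_operator (fun v z => a w z v) setT (Sst w)})
  (CS : Om -> R) (CS_Lfun : Lfun_all P CS)
  (S_cont : {ae P, forall w, forall g : dual V, `|S w g| <= CS w * `|g|})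
  (B : contlin U (dual Z)) (C : contlin W H) (yd : H)
  (nu : R) (nu_gt0 : 0 < nu)
  (Uad : set U) (Uad_closed : closed Uad)
  (Uad_convex : convex_set (Uad : set (convex_lmodType U)))
  (Vl : nat -> set V) (Vl_fin : forall l, fin_dim_subspace (Vl l))
  (h : nat -> R) (h_mesh : mesh_sizes h)
  (Sl Sstl : nat -> Om -> dual V -> V)
  (Sl_def : {ae P, forall w, forall l, galerkin_operator (a w) (Vl l) (Sl l w)})
  (Sstl_def : {ae P, forall w, forall l,
     galerkin_operator (fun v z => a w z v) (Vl l) (Sstl l w)})
  (dq : measure_display) (OmQ : measurableType dq) (PQ : probability OmQ R)
  (Q : nat -> quadrature R Om OmQ)
  (ustar : U)
  (ustar_min : is_minimizer Uad (cost P iZ iW B C yd nu S) ustar)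
  (ulinf : nat -> U)
  (ulinf_min : forall l,
     is_minimizer Uad (cost P iZ iW B C yd nu (Sl l)) (ulinf l))
  (ulk : nat -> nat -> OmQ -> U)
  (ulk_min : {ae PQ, forall w', forall l k,
     is_minimizer Uad (quad_cost iZ iW B C yd nu (Sl l) (Q k) w') (ulk l k w')})
  (gamma : nat -> R) (Hq : R -> normed_fun_space P Z)
  (alphaW alphaZ alphat : R)
  (alphaW_gt0 : 0 < alphaW) (alphaZ_gt0 : 0 < alphaZ) (alphat_gt0 : 0 < alphat)
  (assumption_Q : quadrature_assumption PQ Q gamma Hq)
  (assumption_F :
     finite_element_assumption P iZ iW B C S Sst Sl Sstl h alphaW alphaZ)
  (assumption_M : mixed_regularity_assumption iZ iW B C yd S Sst Sl Sstl h Hq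
                    ustar ulinf alphat)
  (Uad_full : Uad = [set: U]) :
  let alpha := Num.min alphaW alphaZ in
  let beta := Num.min alpha alphat in
  exists C1 C3 : R, [/\ 0 < C1, 0 < C3 & forall L : nat,
    ('E_PQ[(fun w' =>
        `|ustar - multilevel_control iZ iW B C yd nu Uad Sl Sstl Q ulk L w'|
          ^+ 2)%R]
     <= (2 * C1 ^+ 2 * h L `^ (2 * alpha) +
         C3 ^+ 2 * L%:R *
           \sum_(l < L.+1) h l `^ (2 * beta) * gamma (L - l)%N ^+ 2)%:E)%E].
Proof.
move=> alpha beta; subst Uad.
have [unb _ [gdec g0] QC] := assumption_Q.
have [_ [Ca [Cast [Cpos LCa _ FE]]]] := assumption_F.
have [qbar qbar2 M] := assumption_M.
have [h0 [hb hub] [tau0 htau]] := h_mesh.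
have Ca0 w : 0 < Ca w by case: (Cpos w).
have hle l : h l <= hb by apply: hub; exists l.
have hb0 : 0 < hb by exact: lt_le_trans (h0 0%N) (hle 0%N).
have hS l : h l <= tau0 * h l.+1.
  by rewrite -ler_pdivrMr//; apply: htau; exists l.
have tau_gt0 : 0 < tau0.
  by rewrite -(pmulr_lgt0 _ (h0 1%N)); exact: lt_le_trans (h0 0%N) (hS 0%N).
(* A nonincreasing sequence lies above its limit. *)
have gamma0 k : 0 <= gamma k.
  have cg : cvgn gamma by apply/cvg_ex; exists (0 : R); exact: g0.
  by have := nonincreasing_cvgn_ge gdec cg k; rewrite (cvg_lim _ g0).
have alphaW_ge : alpha <= alphaW by rewrite /alpha ge_min lexx.
have beta_le : beta <= alpha by rewrite /beta ge_min lexx.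
have alphat_ge : beta <= alphat by rewrite /beta ge_min lexx orbT.
have beta0 : 0 < beta by rewrite /beta /alpha !lt_min alphaW_gt0 alphaZ_gt0.
pose m1 : R := Num.max 1 hb.
pose eta l : R := h l `^ alphaW; pose hbeta l : R := h l `^ beta.
pose hmax : R := m1 `^ alphaW.
(* The first three constants lower the exponents [alphaW] and [alphat] to [alpha] or [beta]; [ctau]
   passes from one level to the next finer one. *)
pose ca : R := m1 `^ (alphaW - alpha); pose cb : R := m1 `^ (alphaW - beta).
pose ct : R := m1 `^ (alphat - beta); pose ctau : R := tau0 `^ beta.
have eta0 l : 0 <= eta l by exact: powR_ge0.
have etam l : eta l <= hmax.
  rewrite ge0_ler_powR ?nnegrE ?(ltW alphaW_gt0) ?(ltW (h0 l))//.
    by rewrite le_max ler01.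
  by rewrite le_max hle orbT.
have hmax0 : 0 <= hmax by exact: powR_ge0.
have eta_a l : eta l <= ca * h l `^ alpha by exact: powR_le_scaled.
have eta_b l : eta l <= cb * hbeta l.
  by apply: powR_le_scaled => //; exact: le_trans alphaW_ge.
have ht_b l : h l `^ alphat <= ct * hbeta l by exact: powR_le_scaled.
have hbS l : hbeta l <= ctau * hbeta l.+1.
  rewrite /hbeta /ctau -powRM ?(ltW tau_gt0) ?(ltW (h0 _))//.
  by rewrite ge0_ler_powR ?nnegrE ?(ltW beta0) ?(ltW (h0 l)) ?mulr_ge0
    ?(ltW (h0 _)) ?(ltW tau_gt0).
have hb_gt0 l : 0 < hbeta l by exact: powR_gt0.
have hbeta_le l : hbeta l <= m1 `^ beta.
  rewrite ge0_ler_powR ?nnegrE ?(ltW beta0) ?(ltW (h0 l))//.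
    by rewrite le_max ler01.
  by rewrite le_max hle orbT.
have cS : {ae P, forall w, compatible iZ iW B C S Sst w}.
  by apply: filterS2 S_def Sst_def => w; exact: galerkin_compatible.
have cSl l : {ae P, forall w, compatible iZ iW B C (Sl l) (Sstl l) w}.
  apply: filterS2 Sl_def Sstl_def => w gS gSst.
  exact: galerkin_compatible (gS l) (gSst l).
have acc l : {ae P, forall w, accurate iZ iW B CS Ca S (Sl l) (eta l) w}.
  by apply: filterS2 S_cont FE => w Sw [Wle _]; split => // u; exact: Wle.
have two_le : (2 <= (2 : R)) && (2 <= qbar) by rewrite lexx (ltW qbar2).
have qbar_le : (2 <= qbar) && (qbar <= qbar) by rewrite lexx (ltW qbar2).
(* Order 2 serves the level differences; order [qbar > 2] leaves room for Hoelder's inequality in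
   the product with the random density. *)
have [mem2 meml2 [CH2 CH20 rate2]] := M 2 two_le.
have [memq memlq [CHq CHq0 rateq]] := M qbar qbar_le.
have [CQ2 CQ20 quad2] := QC 2 (lexx _).
have [CQq CQq0 quadq] := QC qbar (ltW qbar2).
have iS u : bochner_integrable P (adjoint_variable iZ iW B C yd S Sst u).
  exact: fs_integrable (mem2 u).
have iSl l u :
    bochner_integrable P (adjoint_variable iZ iW B C yd (Sl l) (Sstl l) u).
  exact: fs_integrable (meml2 l u).
have sS := cost_minimizer_stationary P_complete cS iS ustar_min.
have sSl l := cost_minimizer_stationary P_complete (cSl l) (iSl l) (ulinf_min l).
have iD := error_density_integrable iZ iW B C yd CS_Lfun LCa Ca0 hmax0.
pose D := error_density iZ iW B C yd CS Ca hmax.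
pose ED := fine (\int[P]_w (D w)%:E).
have ED0 : 0 <= ED.
  by apply/fine_ge0/integral_ge0 => w _; rewrite lee_fin; exact: error_density_ge0.
pose c1 : R := ED * (1 + `|ustar|) * ca / nu.
have c10 : 0 <= c1.
  by rewrite divr_ge0 ?(ltW nu_gt0)// !mulr_ge0 ?powR_ge0// addr_ge0.
have fe_error l : `|ustar - ulinf l| <= c1 * h l `^ alpha.
  have M0 : 0 <= ED * eta l * (1 + `|ustar|) by rewrite !mulr_ge0// addr_ge0.
  have := solves_norm_le (mean_adj_psd P_complete (cSl l) (iSl l))
    (stationary_sub (mean_adj_psd P_complete (cSl l) (iSl l)) sS (sSl l)) M0
    (mean_adj_sub_le P_complete hmax0 Ca0 ustar (ustar - ulinf l) cS (cSl l)
      (acc l) iS (iSl l) (eta0 l) (etam l) iD).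
  rewrite -ler_pdivlMl// => /le_trans; apply.
  rewrite (_ : _ * (ED * _ * _) = ED * (1 + `|ustar|) / nu * eta l); last by ring.
  rewrite (_ : c1 * _ = ED * (1 + `|ustar|) / nu * (ca * h l `^ alpha)); last first.
    by rewrite /c1; ring.
  by rewrite ler_wpM2l// divr_ge0 ?(ltW nu_gt0)// mulr_ge0// addr_ge0.
pose p l := fun w => adjoint_variable iZ iW B C yd (Sl l) (Sstl l) (ulinf l) w.
pose pst := fun w => adjoint_variable iZ iW B C yd S Sst ustar w.
pose f l := if l is l'.+1 then (fun w => p l w - p l' w) else p 0%N.
pose T l k w' := (ulinf l - ulk l k w') -
  (if l is l'.+1 then ulinf l' - ulk l' k w' else 0).
pose cu : R := `|ustar| + `|yd|.
have cu0 : 0 <= cu by rewrite addr_ge0.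
have ct0 : 0 <= ct by exact: powR_ge0.
have cb0 : 0 <= cb by exact: powR_ge0.
have ctau0 : 0 <= ctau by exact: powR_ge0.
have memf l : fs_mem (Hq 2) (f l).
  by case: l => [|l]; [exact: meml2|apply: fs_memB; exact: meml2].
have [c2 c20 f_le] : exists2 c2, 0 <= c2 &
    forall l, fs_norm (Hq 2) (f l) <= c2 * hbeta l.
  (* Level 0 is not a difference, so no rate is available for it; its norm is divided by [hbeta 0].
     The other levels are compared through [pst]. *)
  pose n0 : R := `|fs_norm (Hq 2) (p 0%N)| / hbeta 0%N.
  have n00 : 0 <= n0 by rewrite divr_ge0// ltW.
  have c0 : 0 <= CH2 * cu * ct * (ctau + 1).
    by rewrite !mulr_ge0 ?(ltW CH20)// addr_ge0.
  exists (n0 + CH2 * cu * ct * (ctau + 1)) => [|[|l]]; first exact: addr_ge0.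
    rewrite mulrDl divfK ?gt_eqF//.
    by rewrite (le_trans (ler_norm _))// lerDl mulr_ge0// ltW.
  have -> : f l.+1 = (fun w => (pst w - p l w) - (pst w - p l.+1 w)).
    by apply/funext => w; rewrite /= opprB [RHS]addrC addrA subrK.
  apply: (le_trans (fs_normB (fs_memB (mem2 _) (meml2 _ _))
    (fs_memB (mem2 _) (meml2 _ _)))).
  apply: (le_trans (lerD (rate2 l) (rate2 l.+1))); rewrite -/cu.
  apply: (@le_trans _ _ (CH2 * cu * ct * (ctau + 1) * hbeta l.+1)); last first.
    by rewrite mulrDl lerDr mulr_ge0// ltW.
  have e1 := ht_b l; have e2 := ht_b l.+1; have e3 := hbS l.
  have e4 : h l `^ alphat <= ct * (ctau * hbeta l.+1).
    by rewrite (le_trans e1)// ler_wpM2l.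
  have cc : 0 <= CH2 * cu by rewrite mulr_ge0// ltW.
  have := ler_wpM2l cc (lerD e4 e2).
  rewrite (_ : CH2 * cu * (h l `^ alphat + h l.+1 `^ alphat) =
    CH2 * h l `^ alphat * cu + CH2 * h l.+1 `^ alphat * cu); last by ring.
  move/le_trans; apply; rewrite le_eqVlt; apply/orP; left; apply/eqP; ring.
have [cq cq0 p_le] : exists2 cq, 0 <= cq & forall l, fs_norm (Hq qbar) (p l) <= cq.
  have c0 : 0 <= CHq * (ct * m1 `^ beta) * cu.
    by rewrite !mulr_ge0 ?(ltW CHq0) ?powR_ge0.
  exists (`|fs_norm (Hq qbar) pst| + CHq * (ct * m1 `^ beta) * cu) => [|l].
    exact: addr_ge0.
  have -> : p l = (fun w => pst w - (pst w - p l w)).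
    by apply/funext => w; rewrite opprB addrC subrK.
  apply: (le_trans (fs_normB (memq _) (fs_memB (memq _) (memlq _ _)))).
  apply: lerD; first exact: ler_norm.
  apply: (le_trans (rateq l)); rewrite -/cu ler_wpM2r// ler_wpM2l ?(ltW CHq0)//.
  by rewrite (le_trans (ht_b l))// ler_wpM2l.
have q20 : 0 < qbar - 2 by rewrite subr_gt0.
have qb0 : 0 < qbar by exact: lt_trans qbar2.
pose r := 2 * (qbar / (qbar - 2)).
have r1 : 1 <= r.
  have : 1 <= qbar / (qbar - 2) by rewrite ler_pdivlMr// mul1r gerBl.
  by rewrite /r; lra.
have iDr := error_density_moment iZ iW B C yd CS_Lfun LCa Ca0 hmax0 r1.
pose Mr := fine (\int[P]_w (D w `^ r)%:E).
have Mr0 : 0 <= Mr.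
  by apply/fine_ge0/integral_ge0 => w _; rewrite lee_fin powR_ge0.
have iMr k : (\int[PQ]_w' ((quad (Q k) w' (D : Om -> R^o) : R) `^ r)%:E <= Mr%:E)%E.
  rewrite /Mr fineK; last exact: integrable_fin_num.
  apply: quad_moment_le => //.
  by move=> w; exact: error_density_ge0.
have ctb0 : 0 <= cb * (1 + ctau) by rewrite mulr_ge0// addr_ge0.
(* Coefficients of the increment estimate; in [b2], both discretization factors are bounded in terms
   of the rate of the finer level. *)
pose b1 : R := opnorm B / nu; pose b2 : R := cb * (1 + ctau) * (opnorm B / nu ^+ 2).
have b10 : 0 <= b1 by rewrite divr_ge0 ?opnorm_ge0// ltW.
have b20 : 0 <= b2 by rewrite mulr_ge0// divr_ge0 ?opnorm_ge0// exprn_ge0// ltW.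
pose K : R := 2 * b1 ^+ 2 * (CQ2 * c2) ^+ 2 +
  2 * b2 ^+ 2 * (Mr `^ ((qbar - 2) / qbar) * (CQq * cq) ^+ 2).
have K0 : 0 <= K.
  have sq (x : R) : 0 <= 2 * x ^+ 2 by rewrite mulr_ge0// sqr_ge0.
  apply: addr_ge0; apply: mulr_ge0 => //; first exact: sqr_ge0.
  by apply: mulr_ge0; [exact: powR_ge0|exact: sqr_ge0].
have qD0 k w' : 0 <= (quad (Q k) w' (D : Om -> R^o) : R).
  apply: sumr_ge0 => j _; apply: mulr_ge0; first exact/ltW/weight_gt0.
  exact: error_density_ge0.
have mlk l k : {ae PQ, forall w', is_minimizer [set: U]
    (quad_cost iZ iW B C yd nu (Sl l) (Q k) w') (ulk l k w')}.
  by apply: filterS ulk_min => w'; exact.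
(* At [l = 0] the predecessor [l.-1] is 0 and the second summand is just a nonnegative surplus. *)
have T_le l k : {ae PQ, forall w', 0 <= `|T l k w'| <=
    b1 * sampling_error P (Q k) (f l) w' + b2 * hbeta l *
    ((quad (Q k) w' (D : Om -> R^o) : R) * sampling_error P (Q k) (p l.-1) w')}.
  case: l => [|l].
    have := level_error_le nu_gt0 (unb k) (cSl 0%N) (sSl 0%N) (mlk 0%N k).
    apply: filterS => w' le0; rewrite normr_ge0 /T subr0 (le_trans le0)//.
    rewrite lerDl; apply: mulr_ge0; first by rewrite mulr_ge0// ltW.
    by apply: mulr_ge0 => //; exact: normr_ge0.
  have := level_increment_le P_complete nu_gt0 (unb k) Ca0 (eta0 l.+1) (etam l.+1)
    (eta0 l) (etam l) (cSl l.+1) (cSl l) (acc l.+1) (acc l) (iSl _ _) (iSl _ _)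
    (fs_integrable (memf l.+1)) (sSl _) (sSl _) (mlk _ _) (mlk _ _).
  apply: filterS => w' le1; rewrite normr_ge0 (le_trans le1)// lerD2l.
  apply: ler_wpM2r; first by apply: mulr_ge0 => //; exact: normr_ge0.
  rewrite (_ : b2 * _ =
      (cb * (1 + ctau) * hbeta l.+1) * (opnorm B / nu ^+ 2)); last first.
    by rewrite /b2; ring.
  rewrite ler_wpM2r ?divr_ge0 ?opnorm_ge0 ?exprn_ge0 ?(ltW nu_gt0)//.
  have e1 := eta_b l.+1; have e2 := eta_b l; have e3 := ler_wpM2l cb0 (hbS l).
  by rewrite mulrDr mulr1 mulrDl lerD// (le_trans e2)// -mulrA.
have term_bound l k : exists G : OmQ -> R, [/\ measurable_fun setT G,
    forall w', 0 <= G w', {ae PQ, forall w', `|T l k w'| ^+ 2 <= G w'} &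
    (\int[PQ]_w' (G w')%:E <= (K * (hbeta l ^+ 2 * gamma k ^+ 2))%:E)%E].
  (* The two norms to be used: the first carries the rate of the level, the second does not, its
     rate being supplied by the coefficient [b2 * hbeta l]. *)
  have N10 : 0 <= CQ2 * gamma k * (c2 * hbeta l).
    by rewrite mulr_ge0// mulr_ge0// ltW.
  have N20 : 0 <= CQq * gamma k * cq by rewrite !mulr_ge0 ?(ltW CQq0).
  have mqD : measurable_fun setT (fun w' => quad (Q k) w' (D : Om -> R^o) : R).
    apply: quad_measurable.
    exact: (error_density_measurable iZ iW B C yd hmax CS_Lfun LCa).
  have b2l0 : 0 <= b2 * hbeta l by rewrite mulr_ge0// ltW.
  have se (g : Om -> Z) : bochner_integrable P g -> exists2 g' : OmQ -> R,
      measurable_fun setT g' &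
      {ae PQ, forall w', sampling_error P (Q k) g w' = g' w'}.
    move=> /bochner_integralP[sg _].
    exact: (quad_error_measurable (unb k) (bochner_integral P g) sg).
  have [] := @combined_second_moment _ _ _ PQ (fun w' => `|T l k w'|)
    (fun w' => quad (Q k) w' (D : Om -> R^o))
    (sampling_error P (Q k) (f l)) (sampling_error P (Q k) (p l.-1))
    b1 (b2 * hbeta l) qbar Mr (CQ2 * gamma k * (c2 * hbeta l)) (CQq * gamma k * cq)
    qbar2 b10 b2l0 Mr0 N10 N20 mqD (qD0 k) (iMr k).
  - exact/se/fs_integrable/memf.
  - exact/se/iSl.
  - apply: (le_trans (quad2 _ _ (memf l))); rewrite lee_fin ler_wpM2l//.
    by rewrite mulr_ge0// ltW.
  - apply: (le_trans (quadq _ _ (memlq _ _))); rewrite lee_fin ler_wpM2l//.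
      by rewrite mulr_ge0// ltW.
    exact: p_le.
  - exact: T_le.
  move=> G [mG G0 TG iG]; exists G; split => //.
  apply: (le_trans iG); rewrite lee_fin le_eqVlt; apply/orP; left; apply/eqP.
  by rewrite /K; ring.
pose prev l k w' := if l is l'.+1 then ulk l' k w' else 0.
have mlc : {ae PQ, forall w', forall L,
    multilevel_control iZ iW B C yd nu setT Sl Sstl Q ulk L w' =
    \sum_(l < L.+1) (ulk l (L - l)%N w' - prev l (L - l)%N w')}.
  have stat : {ae PQ, forall w', forall l k, stationary B nu
      (quad_adj iZ iW B C yd (Q k) w' (Sl l) (Sstl l)) (ulk l k w')}.
    apply: ae_foralln => l; apply: ae_foralln => k.
    have := quad_stationary_ae (unb k) (cSl l) (mlk l k).
    by apply: filterS => w' [].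
  apply: filterS stat => w' st L; rewrite /multilevel_control projectionT.
  set z := \sum_(l < L.+1) quad _ _ _; set x := \sum_(l < L.+1) _.
  (* Level by level this is the optimality condition of the sampled controls; the term of index -1
     is a quadrature of 0. *)
  have -> : adjoint_dual B z = riesz (nu *: x).
    apply: val_inj; apply/funext => v.
    transitivity (pairing (B v) z) => //.
    transitivity (inner (nu *: x) v : R) => //.
    rewrite innerZl innerC /z /x (scalarf_sum (pairing_scalar _)).
    rewrite (scalarf_sum (inner_scalar _)) mulr_sumr; apply: eq_bigr => l _.
    rewrite quadB (scalarfB (pairing_scalar _)) (scalarfB (inner_scalar _)) mulrBr.
    rewrite ![inner v _]innerC; congr (_ - _); first exact/esym/st.
    case: (l : nat) => [|l'] /=; last exact/esym/st.
    rewrite /quad big1 => [|j _]; last by rewrite scaler0.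
    rewrite innerC (scalarf0 (pairing_scalar _)) (scalarf0 (inner_scalar _)).
    by rewrite mulr0.
  by rewrite riesz_inv_riesz scalerA mulVf ?gt_eqF// scale1r.
have telescope L w' : \sum_(l < L.+1) T l (L - l)%N w' =
    ulinf L - \sum_(l < L.+1) (ulk l (L - l)%N w' - prev l (L - l)%N w').
  have -> : ulinf L = \sum_(l < L.+1)
      (ulinf l - if (l : nat) is l'.+1 then ulinf l' else 0).
    elim: L => [|L IHL]; first by rewrite big_ord_recl big_ord0 /= subr0 addr0.
    by rewrite big_ord_recr/= -IHL addrC subrK.
  rewrite -sumrB; apply: eq_bigr => -[[|l] lL] _ /=; rewrite /T /prev/=.
    by rewrite !subr0.
  by rewrite !opprD !opprK !addrA; congr (_ + _); exact: addrAC.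
(* At [L = 0] the second term of the bound vanishes because of its factor [L];
   [y] lets the first constant absorb the sampling error there. *)
pose y : R := hbeta 0%N ^+ 2 * gamma 0%N ^+ 2 / h 0%N `^ (2 * alpha).
have ha0 l : 0 < h l `^ (2 * alpha) by exact: powR_gt0.
have y0 : 0 <= y by rewrite divr_ge0 ?(ltW (ha0 _))// mulr_ge0// sqr_ge0.
(* In the second constant, one factor 2 comes from splitting the square and another from
   [L.+1 <= 2 * L] for positive [L]; the square of [1 + 4 * K] dominates [4 * K]. *)
exists (1 + c1 + K * y), (1 + 4 * K); split.
- by rewrite -addrA ltr_pwDl// addr_ge0// mulr_ge0.
- by rewrite ltr_pwDl// mulr_ge0.
move=> L; pose a2 := `|ustar - ulinf L| ^+ 2.
have /all_sig[G GP] (l : nat) : {G : OmQ -> R | [/\ measurable_fun setT G,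
    forall w', 0 <= G w', {ae PQ, forall w', `|T l (L - l)%N w'| ^+ 2 <= G w'} &
    (\int[PQ]_w' (G w')%:E <=
      (K * (hbeta l ^+ 2 * gamma (L - l)%N ^+ 2))%:E)%E]}.
  exact/cid/term_bound.
have GT : {ae PQ, forall w' l, `|T l (L - l)%N w'| ^+ 2 <= G l w'}.
  by apply: ae_foralln => l; case: (GP l).
have G0 l w' : 0 <= G l w' by case: (GP l).
have mG l : measurable_fun setT (G l) by case: (GP l).
have SG0 w' : 0 <= \sum_(l < L.+1) G l w' by exact: sumr_ge0.
have L10 : 0 <= 2 * L.+1%:R :> R by rewrite mulr_ge0.
have a20 : 0 <= 2 * a2 by rewrite mulr_ge0// sqr_ge0.
pose S2 : R := \sum_(l < L.+1) hbeta l ^+ 2 * gamma (L - l)%N ^+ 2.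
have S20 : 0 <= S2 by apply: sumr_ge0 => l _; rewrite mulr_ge0// sqr_ge0.
rewrite unlock.
(* The squared error is split into the deterministic finite element part and the sum of the [L.+1]
   increments, to which the Cauchy-Schwarz inequality applies. *)
apply: (@le_trans _ _ (\int[PQ]_w'
    (2 * a2 + 2 * L.+1%:R * \sum_(l < L.+1) G l w')%:E)%E).
  apply: ae_le_integral_measurabler.
  - by move=> w'; rewrite lee_fin sqr_ge0.
  - by move=> w'; rewrite lee_fin addr_ge0// mulr_ge0.
  - apply/measurable_EFinP; apply: measurable_funD => //.
    by apply: measurable_funM => //; exact: measurable_sum.
  apply: filterS2 mlc GT => w' -> GTw; rewrite lee_fin.
  have -> : ustar - \sum_(l < L.+1) (ulk l (L - l)%N w' - prev l (L - l)%N w') =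
      (ustar - ulinf L) + \sum_(l < L.+1) T l (L - l)%N w'.
    by rewrite telescope addrA subrK.
  have le1 : `|ustar - ulinf L + \sum_(l < L.+1) T l (L - l)%N w'| <=
      `|ustar - ulinf L| + \sum_(l < L.+1) `|T l (L - l)%N w'|.
    by rewrite (le_trans (ler_normD _ _))// lerD2l ler_norm_sum.
  have le2 := sqr_sum_le (fun l : 'I_L.+1 => `|T l (L - l)%N w'|).
  have le3 : \sum_(l < L.+1) `|T l (L - l)%N w'| ^+ 2 <= \sum_(l < L.+1) G l w'.
    by apply: ler_sum => l _; exact: GTw.
  have s0 : 0 <= \sum_(l < L.+1) `|T l (L - l)%N w'| by exact: sumr_ge0.
  have le4 : L.+1%:R * \sum_(l < L.+1) `|T l (L - l)%N w'| ^+ 2 <=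
      L.+1%:R * \sum_(l < L.+1) G l w' by rewrite ler_wpM2l.
  move: le1 le2 le4 s0; rewrite /a2.
  set s := \sum_(l < L.+1) `|_|; set t := `|_ + _|; set b := `|_ - _|.
  move=> le1 le2 le4 s0.
  have : t ^+ 2 <= (b + s) ^+ 2.
    by rewrite ler_sqr ?nnegrE ?addr_ge0//; exact: normr_ge0.
  have := sqr_ge0 (b - s); rewrite sqrrB sqrrD; lra.
apply: (@le_trans _ _ (2 * a2 + 2 * L.+1%:R * (K * S2))%:E).
  under eq_integral do rewrite EFinD [(2 * L.+1%:R * _)%:E]EFinM -sumEFin.
  have mS : measurable_fun setT (fun w' => (\sum_(l < L.+1) (G l w')%:E)%E).
    by apply: emeasurable_sum => l; exact/measurable_EFinP.
  have S0 w' : (0 <= \sum_(l < L.+1) (G l w')%:E)%E.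
    by apply: sume_ge0 => l _; rewrite lee_fin.
  rewrite ge0_integralD//; first last.
  - by apply: emeasurable_funM.
  - by move=> w' _; rewrite mule_ge0.
  rewrite EFinD leeD//.
    rewrite le_eqVlt; apply/orP; left; apply/eqP.
    by rewrite -[RHS]mule1 -(probability_setT PQ); exact: integral_cst.
  rewrite ge0_integralZl//.
  rewrite [X in (_ <= X)%E]EFinM lee_wpmul2l//.
  rewrite ge0_integral_sum//; first last.
  - by move=> l w' _; rewrite lee_fin.
  - by move=> l; exact/measurable_EFinP.
  rewrite /S2 mulr_sumr -sumEFin; apply: lee_sum => l _.
  by case: (GP l).
rewrite lee_fin.
have -> : \sum_(l < L.+1) h l `^ (2 * beta) * gamma (L - l)%N ^+ 2 = S2.
  apply: eq_bigr => l _; congr (_ * _).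
  by rewrite /hbeta mulrC powRrM powR_mulrn ?powR_ge0.
have ha : h L `^ (2 * alpha) = (h L `^ alpha) ^+ 2.
  by rewrite mulrC powRrM powR_mulrn ?powR_ge0.
have a2_le : a2 <= c1 ^+ 2 * h L `^ (2 * alpha).
  have ch0 : 0 <= c1 * h L `^ alpha by apply: mulr_ge0 => //; exact: powR_ge0.
  by rewrite ha -exprMn ler_sqr ?nnegrE//; exact: fe_error.
have hL := ha0 L; have Ky : 0 <= K * y by rewrite mulr_ge0.
have [L0|Lpos] := posnP L.
  have S2E : S2 = y * h L `^ (2 * alpha).
    by rewrite /S2 L0 big_ord_recl big_ord0 addr0 /= subn0 /y divfK ?gt_eqF.
  have -> : (1 + 4 * K) ^+ 2 * L%:R * S2 = 0 by rewrite L0 mulr0 mul0r.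
  have -> : L.+1%:R = 1 :> R by rewrite L0.
  have : 0 <= (1 + c1 + K * y) ^+ 2 - c1 ^+ 2 - K * y.
    rewrite (_ : _ - _ = 1 + K * y + 2 * c1 + (K * y) ^+ 2 + 2 * (c1 * (K * y))).
      by have := sqr_ge0 (K * y); have := mulr_ge0 c10 Ky; lra.
    by ring.
  move/(mulr_ge0 (ltW hL)); rewrite S2E; lra.
have le5 : L.+1%:R <= 2 * L%:R :> R.
  by rewrite -natrM ler_nat mul2n -addnn -addn1 leq_add2l.
have KS0 : 0 <= 2 * (K * S2) by rewrite !mulr_ge0.
have le7 := ler_wpM2r KS0 le5.
have le8 : a2 <= (1 + c1 + K * y) ^+ 2 * h L `^ (2 * alpha).
  rewrite (le_trans a2_le)// ler_wpM2r ?(ltW hL)//.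
  by rewrite ler_sqr ?nnegrE ?addr_ge0//; lra.
have le9 : 4 * K <= (1 + 4 * K) ^+ 2.
  by have := sqr_ge0 (4 * K); rewrite sqrrD expr1n mul1r; lra.
have LS0 : 0 <= L%:R * S2 by rewrite mulr_ge0.
have := ler_wpM2r LS0 le9; lra.
Qed.
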